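(* Let $\sigma=(\sigma_j)_{j\in\mathbb N}\in\ell_2$ be a non-increasing sequence of non-negative real numbers. For $n\in\mathbb N$ let $A_n$ be the least squares algorithm with parameter $k=n$. Then, for all $n\in\mathbb N$ and all $c,s\in[1,\infty)$, $$\mathbb P\Big[\mathcal R_n(\sigma)\le e(A_n)\le 14\,s\,n\Big(\sum_{j>n}\sigma_j^2\Big)^{1/2}\Big]\ \ge\ 1-e^{-c^2n}-\frac{c\sqrt{2e}}{s}.$$
   Context: Convention: $a/0=\infty$ for $a>0$ and $0/0=0$. Put $H_\sigma=\{x\in\ell_2:\sum_{j\in\mathbb N}(x_j/\sigma_j)^2<\infty\}$ and $\mathcal E_\sigma=\{x\in\ell_2:\sum_{j\in\mathbb N}(x_j/\sigma_j)^2\le 1\}$. $G_n=(g_{ij})_{1\le i\le n,\,j\in\mathbb N}$ is a random matrix with independent standard Gaussian entries, and $G_nx=(\sum_{j}g_{ij}x_j)_{i=1}^n$, where a component is assigned the value NaN if its series does not converge (for $\sigma\in\ell_2$, almost surely all these series converge for all $x\in H_\sigma$). The radius of random information is $$\mathcal R_n(\sigma)=\inf_{\phi}\ \sup_{x\in\mathcal E_\sigma}\|\phi(G_nx)-x\|_2,$$ the infimum being over all mappings $\phi$ from the image of $G_n$ (on $H_\sigma$) to $\ell_2$. Least squares algorithm with parameter $k\le n$: identify $\mathbb R^k$ with $\{x\in\ell_2: x_j=0\text{ for all }j>k\}$, let $\psi=(g_{ij})_{1\le i\le n,1\le j\le k}\in\mathbb R^{n\times k}$ be the restriction of $G_n$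 to $\mathbb R^k$, let $\psi^+$ be its Moore–Penrose inverse, and set $A_n(x)=\psi^+(G_nx)\in\mathbb R^k\subset\ell_2$. Its worst case error is $e(A_n)=\sup_{x\in\mathcal E_\sigma}\|A_n(x)-x\|_2$. *)

(* Defs.v *)
From HB Require Import structures.
From mathcomp Require Import all_boot all_order all_algebra finmap.
From mathcomp Require Import all_classical all_reals all_analysis.

Set Implicit Arguments.
Unset Strict Implicit.
Unset Printing Implicit Defensive.
Import Order.TTheory GRing.Theory Num.Theory.
Import numFieldNormedType.Exports.

Local Open Scope classical_set_scope.
Local Open Scope ring_scope.

(** Sequences are indexed from [0]: the coordinate written [x_j], [j >= 1], on
    paper is [x j.-1] here, so that a sum over [j > n] runs over the indices
    [>= n]. *)

Section ell2.
Context {R : realType}.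
Implicit Types x sigma : nat -> R.

Definition l2norm x : \bar R := 'N[counting]_(2%:E)[EFin \o x]%E.

Definition ell2 : set (nat -> R) := [set x | (l2norm x < +oo)%E].

(** The division is that of [\bar R], where [0^-1 = +oo] and [0 * +oo = 0];
    see [hsqnorm_div0] and [hsqnorm_div00]. *)
Definition hsqnorm sigma x : \bar R :=
  (\sum_(0 <= j <oo) ((x j)%:E / (sigma j)%:E) ^+ 2)%E.

Lemma hsqnorm_div0 (a : R) : a != 0 -> ((a%:E / 0%:E) ^+ 2 = +oo :> \bar R)%E.
Proof.
move=> a0; rewrite inver eqxx expe2.
have [a_gt0|a_lt0|/eqP] := ltgtP 0 a; last by rewrite eq_sym (negbTE a0).
- by rewrite gt0_muley// lte_fin.
- by rewrite lt0_muley// lte_fin.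
Qed.

Lemma hsqnorm_div00 : ((0%:E / 0%:E) ^+ 2 = 0 :> \bar R)%E.
Proof. by rewrite mul0e expe2 mul0e. Qed.

Definition Hspace sigma : set (nat -> R) :=
  [set x | ell2 x /\ (hsqnorm sigma x < +oo)%E].

Definition ellipsoid sigma : set (nat -> R) :=
  [set x | ell2 x /\ (hsqnorm sigma x <= 1)%E].

Definition worst_case_error sigma (A : (nat -> R) -> (nat -> R)) : \bar R :=
  ereal_sup [set l2norm (A x \- x) | x in ellipsoid sigma].

End ell2.

Section information.
Context {R : realType} {n : nat}.
Variable G : 'I_n -> nat -> R.

(** [None] stands for NaN. *)
Definition info (x : nat -> R) : 'cV[option R]_n :=
  \col_i let u := [series G i j * x j]_j in
    if `[< cvgn u >] then Some (limn u) else None.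

(** The maps [phi] are total, but only their values on the image of [Hspace]
    matter, and only these are required to be in [ell2]. *)
Definition information_radius (sigma : nat -> R) : \bar R :=
  ereal_inf [set worst_case_error sigma (phi \o info) |
    phi in [set phi : 'cV[option R]_n -> (nat -> R) |
      set_fun (info @` Hspace sigma) ell2 phi]].

End information.

Section moore_penrose.
Context {R : realType}.

Definition is_moore_penrose m k (A : 'M[R]_(m, k)) (X : 'M[R]_(k, m)) : Prop :=
  [/\ A *m X *m A = A, X *m A *m X = X,
      (A *m X)^T = A *m X & (X *m A)^T = X *m A].

Definition moore_penrose m k (A : 'M[R]_(m, k)) : 'M[R]_(k, m) :=
  get (is_moore_penrose A).

Let gram_unit m k (A : 'M[R]_(m, k)) : row_free A -> A *m A^T \in unitmx.
Proof.
move=> fA; rewrite -row_free_unit -kermx_eq0; apply/eqP/row_matrixP => i.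
rewrite row0; set v := row i _.
have vAA : v *m (A *m A^T) = 0.
  by apply/sub_kermxP; rewrite /v row_sub.
have vA : v *m A = 0.
  have : (v *m A) *m (v *m A)^T = 0.
    by rewrite trmx_mul mulmxA -(mulmxA v) vAA mul0mx.
  move=> /matrixP/(_ ord0 ord0); rewrite !mxE => s0.
  apply/matrixP => a j; rewrite (ord1 a) [RHS]mxE.
  apply/eqP; rewrite -sqrf_eq0 expr2; apply/eqP.
  have ge0 l : true -> 0 <= (v *m A) ord0 l * (v *m A)^T l ord0.
    by rewrite [X in _ * X]mxE -expr2 sqr_ge0.
  have /(_ j isT) := psumr_eq0P (P := predT) ge0 s0.
  by rewrite [X in _ * X]mxE.
by apply: (row_free_inj fA); rewrite vA mul0mx.
Qed.

Lemma moore_penroseP m k (A : 'M[R]_(m, k)) :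
  is_moore_penrose A (moore_penrose A).
Proof.
pose r := \rank A.
pose B : 'M[R]_(r, k) := row_base A; pose C : 'M[R]_(m, r) := col_base A.
have CB : C *m B = A by exact: mulmx_base.
have uB : B *m B^T \in unitmx by apply: gram_unit; exact: row_base_free.
have uC : C^T *m C \in unitmx.
  rewrite -{2}(trmxK C); apply: gram_unit.
  by rewrite /row_free mxrank_tr; have := col_base_full A; rewrite /row_full.
pose M := invmx (B *m B^T); pose N := invmx (C^T *m C).
have BM : B *m B^T *m M = 1%:M by exact: mulmxV.
have NC : N *m (C^T *m C) = 1%:M by exact: mulVmx.
pose X := B^T *m M *m N *m C^T.
have MT : M^T = M by rewrite /M trmx_inv trmx_mul trmxK.
have NT : N^T = N by rewrite /N trmx_inv trmx_mul trmxK.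
have AX : A *m X = C *m N *m C^T.
  have -> : A *m X = C *m (B *m B^T *m M) *m N *m C^T.
    by rewrite -CB /X !mulmxA.
  by rewrite BM mulmx1.
have XA : X *m A = B^T *m M *m B.
  have -> : X *m A = B^T *m M *m (N *m (C^T *m C)) *m B.
    by rewrite -CB /X !mulmxA.
  by rewrite NC mulmx1.
clearbody M N B C.
apply: (@getPex _ (is_moore_penrose A)); exists X; split.
- have -> : A *m X *m A = C *m (N *m (C^T *m C)) *m B.
    by rewrite AX -CB !mulmxA.
  by rewrite NC mulmx1.
- have -> : X *m A *m X = B^T *m M *m (B *m B^T *m M) *m N *m C^T.
    by rewrite XA /X !mulmxA.
  by rewrite BM mulmx1.
- by rewrite AX !trmx_mul trmxK NT mulmxA.
- by rewrite XA !trmx_mul trmxK MT mulmxA.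
Qed.

End moore_penrose.

Section least_squares.
Context {R : realType} {n : nat}.
Variable G : 'I_n -> nat -> R.

Definition embed k (v : 'cV[R]_k) : nat -> R :=
  fun j => if insub j is Some i then v i ord0 else 0.

Definition restr k : 'M[R]_(n, k) := \matrix_(i < n, j < k) G i j.

(** NaN components of the information are replaced by [0]. *)
Definition least_squares k (x : nat -> R) : nat -> R :=
  embed (moore_penrose (restr k) *m map_mx (odflt 0) (info G x)).

End least_squares.

Section random_matrix.
Context {R : realType} {d : measure_display} {T : measurableType d}.
Variable P : probability T R.

Definition mutually_independent (I : choiceType) (X : I -> {RV P >-> R}) :=
  forall (J : {fset I}) (B : I -> set R),
    (forall i, i \in J -> measurable (B i)) ->
    (P (\bigcap_(i in [set` J]) (X i @^-1` B i)) =
     \prod_(i <- J) P (X i @^-1` B i))%E.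

Definition standard_gaussian (X : {RV P >-> R}) :=
  forall B : set R, measurable B -> distribution P X B = normal_prob 0 1 B.

Definition gaussian_matrix n (g : 'I_n -> nat -> {RV P >-> R}) :=
  mutually_independent (fun ij : 'I_n * nat => g ij.1 ij.2) /\
  forall i j, standard_gaussian (g i j).

End random_matrix.

(* Main.v *)
Require Import Defs.
From HB Require Import structures.
From mathcomp Require Import all_boot all_order all_algebra finmap.
From mathcomp Require Import all_classical all_reals all_analysis.
From mathcomp Require Import perm measurable_realfun ring lra.

Set Implicit Arguments.
Unset Strict Implicit.
Unset Printing Implicit Defensive.
Import Order.TTheory GRing.Theory Num.Theory.
Import numFieldNormedType.Exports.

Local Open Scope classical_set_scope.
Local Open Scope ring_scope.

(* On the tail space, the information has operator norm at most its
   Hilbert-Schmidt norm, and the square of the latter is a weighted sum of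
   chi-square variables with [n] degrees of freedom, controlled by a Chernoff
   bound. The error of the least squares algorithm is then governed by the norm
   of the inverse of the square Gaussian matrix M formed by the first n columns.

   By rotation invariance, |M^-1 u| for a fixed unit vector u is distributed as
   the inverse of the distance of a row of M to the span of the other rows, that
   is of the absolute value of a standard normal variable, so it exceeds y with
   probability at most 1/y. A fixed proportion of the sign vectors e satisfies
   <a, e>^2 >= |a|^2 / 5 for any given a (second and fourth moments). Hence, if
   few sign vectors are amplified by M^-1, then M^-1 has small norm, and Markov's
   inequality for the number of amplified sign vectors bounds the norm of M^-1 by
   a multiple of sqrt n, without the loss of a union bound over the rows. *)

(** * Rotation invariance of the standard normal law *)

(** The only tail available for |M^-1| is of order 1/y, and it costs the term c/s, while the tail of
    the information is too large only with exponentially small probability. The two bad events are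
    joined by a union bound. Off them, |M^-1|^2 is at most 5 x^2 n and the squared Hilbert-Schmidt
    norm at most 6 c^2 n times the tail sum; the choice x = 5 s / (2 c) makes c cancel in the
    product, which becomes a multiple of (s n)^2, and leaves the failure probability 2 c / s for the
    inverse.

    Two obstacles shape the route. Independence is given on boxes only, so every use of a joint law
    (rotating variables, freezing some rows) must pass to all measurable sets by uniqueness of
    measures; accordingly, rotation invariance is proved in coordinate planes and orthogonal
    matrices are assembled from plane rotations. Moreover the inverse is undefined on singular
    matrices; events are therefore stated with determinant, cofactors and adjugate, which are
    polynomial in the entries and hence measurable. *)

Section affine_change.
Context {R : realType}.
Local Notation mu := (@lebesgue_measure R).

Lemma measurable_affine (a b : R) :
  measurable_fun [set: R] (fun x : R => a * x + b).
Proof. by apply: measurable_funD => //; apply: measurable_funM. Qed.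

(** The image of Lebesgue measure under [x -> a x + b], scaled by [a], gives half-open intervals
    their length, so it is Lebesgue measure. *)
Lemma ge0_integral_affine (a b : R) (f : R -> \bar R) : 0 < a ->
  measurable_fun [set: R] f -> (forall x, 0 <= f x)%E ->
  (\int[mu]_x f x = a%:E * \int[mu]_x f (a * x + b)%R)%E.
Proof.
move=> a0 mf f0.
pose h : measurableTypeR R -> measurableTypeR R := fun x : R => a * x + b.
have mh : measurable_fun [set: measurableTypeR R] h by exact: measurable_affine.
pose k : {nonneg R} := NngNum (ltW a0).
pose nu' : {measure set (measurableTypeR R) -> \bar R} := mscale k (pushforward mu h).
pose nu := nu' mh.
have nuE A : measurable A -> mu A = nu A.
  apply: lebesgue_measure_unique => _ [[p q] _ <-] /=.
  rewrite /nu /nu' /= /mscale /= /pushforward /=.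
  have -> : h @^-1` `]p, q]%classic = `](p - b) / a, (q - b) / a]%classic.
    apply/seteqP; split => x; rewrite /= !in_itv /= /h;
    by rewrite ltr_pdivrMr// ler_pdivlMr// ltrBlDr lerBrDr mulrC.
  rewrite !lebesgue_measure_itv /= !lte_fin.
  rewrite ltr_pM2r ?invr_gt0// ltrD2r.
  case: ifPn => pq; last by rewrite mule0.
  rewrite -!EFinB -EFinM; congr (_%:E).
  by field; rewrite gt_eqF.
transitivity (\int[nu]_x f x)%E.
  by apply: eq_measure_integral => A mA _; exact: nuE.
rewrite /nu /nu' ge0_integral_mscale//=; last first.
by rewrite ge0_integral_pushforward.
Qed.

(** The Radon-Nikodym derivative of [normal_prob] gives the change of variables, and it agrees
    almost everywhere with [normal_pdf] because both have the same integral over every measurable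
    set. *)
Lemma ge0_integral_normal_prob (f : R -> \bar R) :
  measurable_fun [set: R] f -> (forall x, 0 <= f x)%E ->
  (\int[normal_prob 0 1]_x f x = \int[mu]_x (f x * (normal_pdf 0 1 x)%:E))%E.
Proof.
move=> mf f0.
have dom := normal_prob_dominates (0 : R) 1.
rewrite -(Radon_Nikodym_SigmaFinite.change_of_variables dom)//.
apply: ae_eq_integral => //.
- apply: emeasurable_funM => //.
  exact: (measurable_int _ (Radon_Nikodym_SigmaFinite.f_integrable dom)).
- apply: emeasurable_funM => //.
  by apply/measurable_EFinP; exact: measurable_normal_pdf.
- suff : ae_eq mu setT (Radon_Nikodym_SigmaFinite.f (normal_prob 0 1) mu)
      (EFin \o normal_pdf 0 1) by apply: filterS => x /= + _ => ->.
  apply: integral_ae_eq => //.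
  + exact: Radon_Nikodym_SigmaFinite.f_integrable.
  + by apply/measurable_EFinP; exact: measurable_normal_pdf.
  + by move=> A _ mA; rewrite -Radon_Nikodym_SigmaFinite.f_integral.
Qed.

End affine_change.

Section rotation2.
Context {R : realType}.
Local Notation mu := (@lebesgue_measure R).
Local Notation N := (@normal_prob R 0 1).
Local Notation phi := (@normal_pdf R 0 1).

Lemma normal_prob_indic (A : set (measurableTypeR R)) : measurable A ->
  N A = (\int[mu]_x ((\1_A x)%:E * (phi x)%:E))%E.
Proof.
move=> mA; rewrite -ge0_integral_normal_prob//; last first.
  by apply/measurable_EFinP; exact: measurable_indic.
by rewrite integral_indic// setIT.
Qed.

Lemma normal_pdf_mul_sqr (x y u v : R) : x ^+ 2 + y ^+ 2 = u ^+ 2 + v ^+ 2 ->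
  phi x * phi y = phi u * phi v.
Proof.
move=> xyuv; rewrite !normal_pdfE ?oner_neq0// /normal_fun !subr0.
rewrite [LHS]mulrACA [RHS]mulrACA -!expRD; congr (_ * expR _).
by rewrite -!mulrDl -!opprD xyuv.
Qed.

(* One affine substitution in each variable, one after the other, realizes the
   rotation; the first one divides by [c]. *)
Lemma normal_prob_rotation (c s : R) (A B : set R) :
  0 < c -> c ^+ 2 + s ^+ 2 = 1 -> measurable A -> measurable B ->
  (N \x N)%E ((fun z : R * R => (c * z.1 + s * z.2, c * z.2 - s * z.1)) @^-1`
    (A `*` B)) = (N A * N B)%E.
Proof.
move=> c0 cs1 mA mB.
pose F (x y : R) : \bar R := (\1_A (c * x + s * y) * \1_B (c * y - s * x) *
  (phi x * phi y))%:E.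
have c1 : 0 < c^-1 by rewrite invr_gt0.
have F0 x y : (0 <= F x y)%E.
  by rewrite lee_fin !mulr_ge0 ?normal_pdf_ge0// indicE ler0n.
have mphi : measurable_fun [set: R] phi by exact: measurable_normal_pdf.
have mFg d (T : measurableType d) (f g : T -> R) : measurable_fun setT f ->
    measurable_fun setT g -> measurable_fun setT (fun t => F (f t) (g t)).
  move=> mf mg; apply/measurable_EFinP.
  apply: measurable_funM; first apply: measurable_funM.
  - apply: (@measurableT_comp _ _ _ _ _ _ (\1_A : R -> R) _ (fun t => c * f t + s * g t)).
      exact: measurable_indic.
    by apply: measurable_funD; exact: measurable_funM.
  - apply: (@measurableT_comp _ _ _ _ _ _ (\1_B : R -> R) _ (fun t => c * g t - s * f t)).
      exact: measurable_indic.
    by apply: measurable_funB; exact: measurable_funM.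
  - by apply: measurable_funM; exact: measurableT_comp.
have mrot : measurable_fun [set: R * R]
    (fun z : R * R => (c * z.1 + s * z.2, c * z.2 - s * z.1)).
  apply/measurable_fun_pairP; split => /=.
    by apply: measurable_funD; apply: measurable_funM.
  by apply: measurable_funB; apply: measurable_funM.
have mS : measurable ((fun z : R * R => (c * z.1 + s * z.2, c * z.2 - s * z.1))
    @^-1` (A `*` B)).
  by rewrite -[X in measurable X]setTI; apply: mrot => //; exact: measurableX.
transitivity (\int[mu]_x \int[mu]_y F x y)%E.
  rewrite /product_measure1 ge0_integral_normal_prob//; last first.
    exact: (@measurable_fun_xsection _ _ _ _ _ N).
  apply: eq_integral => x _.
  rewrite /= normal_prob_indic; last exact: measurable_xsection.
  rewrite -ge0_integralZr//; last 3 first.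
  - apply/measurable_EFinP/measurable_funM => //.
    by apply: measurable_indic; exact: measurable_xsection.
  - by move=> y _; rewrite lee_fin mulr_ge0 ?normal_pdf_ge0// indicE ler0n.
  - by rewrite lee_fin normal_pdf_ge0.
  apply: eq_integral => y _.
  rewrite -!EFinM /F; congr (_%:E).
  rewrite -mulrA [phi y * _]mulrC; congr (_ * _).
  rewrite !indicE -natrM mulnb; congr (_%:R); congr nat_of_bool.
  rewrite mem_xsection; apply/idP/andP => [|[]]; by rewrite !inE.
transitivity (\int[mu]_y \int[mu]_x F x y)%E.
  apply: (@fubini_tonelli _ _ (measurableTypeR R) (measurableTypeR R) _ mu mu
    (fun z => F z.1 z.2)) => [|z]; last exact: F0.
  exact: mFg.
(* The substitution x = (u - s y) / c makes the first rotated coordinate equal to u; afterwards y =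
   c v + s u makes the second one equal to v. The Jacobians 1/c and c cancel. *)
transitivity (\int[mu]_y \int[mu]_u (c^-1%:E * F (c^-1 * u - c^-1 * s * y)%R y))%E.
  apply: eq_integral => y _.
  rewrite (@ge0_integral_affine _ c^-1 (- (c^-1 * s * y)))//; last exact: mFg.
  rewrite ge0_integralZl//; last by rewrite lee_fin ltW.
  by apply: mFg => //; exact: measurable_affine.
transitivity (\int[mu]_u \int[mu]_y (c^-1%:E * F (c^-1 * u - c^-1 * s * y)%R y))%E.
  apply: (@fubini_tonelli _ _ (measurableTypeR R) (measurableTypeR R) _ mu mu
    (fun z => c^-1%:E * F (c^-1 * z.2 - c^-1 * s * z.1)%R z.1)%E) => [|z]; last first.
    by rewrite mule_ge0// lee_fin ltW.
  apply: measurable_funeM; apply: mFg => //.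
  by apply: measurable_funB; exact: measurable_funM.
transitivity (\int[mu]_u \int[mu]_v
  ((\1_A u * phi u)%:E * (\1_B v * phi v)%:E))%E.
  apply: eq_integral => u _.
  rewrite (@ge0_integral_affine _ c (s * u)) //; last 2 first.
  - apply: measurable_funeM; apply: mFg => //.
    by apply: measurable_funB => //; exact: measurable_funM.
  - by move=> x; rewrite mule_ge0// lee_fin ltW.
  rewrite -ge0_integralZl//; last 3 first.
  - apply: measurable_funeM; apply: mFg; last exact: measurable_affine.
    apply: measurable_funB => //; apply: measurable_funM => //.
    exact: measurable_affine.
  - by move=> x _; rewrite mule_ge0// lee_fin ltW.
  - by rewrite lee_fin ltW.
  apply: eq_integral => v _.
  rewrite /F -!EFinM mulVKf ?gt_eqF//; congr (_%:E).
  have -> : c^-1 * u - c^-1 * s * (c * v + s * u) = c * u - s * v.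
    transitivity (c^-1 * (1 - s ^+ 2) * u - s * v).
      by field; rewrite gt_eqF.
    by rewrite -cs1; field; rewrite gt_eqF.
  have -> : c * (c * u - s * v) + s * (c * v + s * u) = u.
    by rewrite -[RHS]mul1r -cs1; ring.
  have -> : c * (c * v + s * u) - s * (c * u - s * v) = v.
    by rewrite -[RHS]mul1r -cs1; ring.
  rewrite (@normal_pdf_mul_sqr _ _ u v); first by rewrite mulrACA.
  by rewrite -[RHS]mul1r -cs1; ring.
have mAphi (C : set R) : measurable C ->
    measurable_fun setT (fun x => (\1_C x * phi x)%:E).
  by move=> mC; apply/measurable_EFinP/measurable_funM => //; exact: measurable_indic.
have Aphi0 (C : set R) x : (0 <= (\1_C x * phi x)%:E)%E.
  by rewrite lee_fin mulr_ge0 ?normal_pdf_ge0// indicE ler0n.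
rewrite !normal_prob_indic// -ge0_integralZr//; last 3 first.
- exact: mAphi.
- by move=> x _; rewrite -EFinM.
- by apply: integral_ge0 => x _; rewrite -EFinM.
apply: eq_integral => u _; rewrite ge0_integralZl//; exact: mAphi.
Qed.

End rotation2.

(** * Families of independent standard normal variables *)

Lemma measurable_preimageT d d' (T : measurableType d) (T' : measurableType d')
    (X : T -> T') (B : set T') :
  measurable_fun [set: T] X -> measurable B -> measurable (X @^-1` B).
Proof. by move=> mX mB; rewrite -[X in measurable X]setTI; exact: mX. Qed.

Section iid_gaussian.
Context {R : realType} {d : measure_display} {T : measurableType d}.
Variable P : probability T R.
Local Notation N := (@normal_prob R 0 1).

(** One product formula over the whole finite index type carries both the independence and the laws:
    choosing [setT] for some indices yields the marginals. *)
Definition iid_gaussian (I : finType) (X : I -> T -> R) :=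
  (forall i, measurable_fun [set: T] (X i)) /\
  forall B : I -> set R, (forall i, measurable (B i)) ->
    P (\bigcap_i (X i @^-1` B i)) = (\prod_i N (B i))%E.

Lemma gaussian_matrix_iid (n : nat) (g : 'I_n -> nat -> {RV P >-> R})
    (I : finType) (h : I -> 'I_n * nat) :
  gaussian_matrix g -> injective h ->
  iid_gaussian (fun i => g (h i).1 (h i).2).
Proof.
move=> [indep gauss] injh; split=> [i|B mB]; first exact: measurable_funP.
pose B' k := if [pick i | h i == k] is Some i then B i else setT.
have B'E i : B' (h i) = B i.
  rewrite /B'; case: pickP => [j /eqP/injh -> //|/(_ i)].
  by rewrite eqxx.
pose J : {fset 'I_n * nat} := [fset h i | i in I]%fset.
have mB' k : measurable (B' k) by rewrite /B'; case: pickP.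
have := indep J B' (fun k _ => mB' k).
have -> : \bigcap_(i in [set` J]) (g i.1 i.2 @^-1` B' i) =
    \bigcap_i (g (h i).1 (h i).2 @^-1` B i).
  apply/seteqP; split => w H k.
    by move=> _; have := H (h k); rewrite B'E; apply; rewrite /= in_imfset.
  by move=> /= /imfsetP[i _ ->]; rewrite B'E; exact: H.
move=> ->.
rewrite big_imfset/=; last by move=> *; exact: injh.
rewrite big_enum/=; apply: eq_bigr => i _.
by rewrite B'E; exact: gauss.
Qed.

Lemma iid_gaussian_comp (I J : finType) (h : J -> I) (X : I -> T -> R) :
  injective h -> iid_gaussian X -> iid_gaussian (X \o h).
Proof.
move=> injh [mX XE]; split=> [i|B mB]; first exact: mX.
pose h' k := [pick j | h j == k].
pose B' k := if h' k is Some j then B j else setT.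
have h'h j : h' (h j) = Some j.
  by rewrite /h'; case: pickP => [j' /eqP/injh -> //|/(_ j)]; rewrite eqxx.
have B'E j : B' (h j) = B j by rewrite /B' h'h.
have mB' k : measurable (B' k) by rewrite /B'; case: (h' k).
have -> : \bigcap_j ((X \o h) j @^-1` B j) = \bigcap_i (X i @^-1` B' i).
  apply/seteqP; split => w H k _ /=.
    rewrite /B' /h'; case: pickP => // j /eqP <-; exact: H.
  by have := H (h k) Logic.I; rewrite /= B'E.
rewrite XE//.
rewrite (bigID (fun k => h' k != None))/= [X in (_ * X)%E]big1 ?mule1; last first.
  by move=> k; rewrite negbK /B' => /eqP ->; rewrite probability_setT.
rewrite (reindex_omap h h')/=; last first.
  by move=> k; rewrite /h'; case: pickP => //= j /eqP ->.
apply: eq_big => j; first by rewrite h'h eqxx.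
by rewrite B'E.
Qed.

(** The restriction of [P] to [C], pushed forward by the pair, agrees with a multiple of the product
    measure on rectangles, hence everywhere. [C] is meant for the conditions on the other variables
    of a family and [k] for its probability. *)
Lemma prob_pair_event (X Y : T -> R) (C : set T) (k : \bar R) :
  measurable_fun [set: T] X -> measurable_fun [set: T] Y -> measurable C ->
  (0 <= k)%E -> k \is a fin_num ->
  (forall A B, measurable A -> measurable B ->
    P (X @^-1` A `&` Y @^-1` B `&` C) = (k * (N A * N B))%E) ->
  forall S : set (R * R), measurable S ->
    P ((fun w => (X w, Y w)) @^-1` S `&` C) = (k * (N \x N) S)%E.
Proof.
move=> mX mY mC k0 kfin PE S mS.
pose k' : {nonneg R} := NngNum (fine_ge0 k0).
have k'E : k = k'%:num%:E by rewrite /= fineK.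
pose XY : T -> (measurableTypeR R * measurableTypeR R)%type := fun w => (X w, Y w).
have mXY : measurable_fun [set: T] XY by exact: measurable_fun_pair.
pose nu' : {measure set (measurableTypeR R * measurableTypeR R) -> \bar R} :=
  pushforward (mrestr P mC) XY.
pose nu := nu' mXY.
transitivity ((mscale k' N \x N)%E S).
  transitivity (nu S) => //; apply: esym.
  apply: product_measure_unique => // A B mA mB.
  by rewrite /mscale/= -muleA -k'E -PE.
rewrite /product_measure1 ge0_integral_mscale//; first by rewrite k'E.
exact: (@measurable_fun_xsection _ _ _ _ _ N).
Qed.

(** Rotating turns a rectangle in the variables [p] and [q] into a set that is no longer one, so the
    product formula of the hypothesis must be extended by [prob_pair_event] before the planar
    invariance applies. *)
Lemma iid_gaussian_rotation (I : finType) (X : I -> T -> R) (p q : I) (c s : R) :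
  p != q -> 0 < c -> c ^+ 2 + s ^+ 2 = 1 -> iid_gaussian X ->
  iid_gaussian (fun i w => if i == p then c * X p w + s * X q w
                           else if i == q then c * X q w - s * X p w
                           else X i w).
Proof.
move=> pq c0 cs1 [mX XE]; split=> [i|B mB].
  case: (i == p); first by apply: measurable_funD; exact: measurable_funM.
  by case: (i == q) => //; apply: measurable_funB; exact: measurable_funM.
pose C := \bigcap_(i in [set i | i != p /\ i != q]) (X i @^-1` B i).
pose k := (\prod_(i | (i != p) && (i != q)) N (B i))%E.
have mC : measurable C.
  apply: fin_bigcap_measurable => [|i _]; last exact: measurable_preimageT.
  exact: finite_finset.
have k0 : (0 <= k)%E by apply: prode_ge0.
have kfin : k \is a fin_num.
  by apply: prode_fin_num => i _; exact: (fin_num_measure N _ (mB i)).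
pose Y i w := if i == p then c * X p w + s * X q w
              else if i == q then c * X q w - s * X p w else X i w.
pose rho := fun z : R * R => (c * z.1 + s * z.2, c * z.2 - s * z.1).
have YE : \bigcap_i (Y i @^-1` B i) =
    (fun w => (X p w, X q w)) @^-1` (rho @^-1` (B p `*` B q)) `&` C.
  apply/seteqP; split => w.
    move=> H; split => /=.
      have := H p Logic.I; have := H q Logic.I; rewrite /Y /= !eqxx eq_sym (negbTE pq).
      by split.
    move=> i [ip iq]; have := H i Logic.I.
    by rewrite /Y /= (negbTE ip) (negbTE iq).
  move=> [[/= Hp Hq] HC] i _; rewrite /Y /=.
  case: eqVneq => [->//|ip]; case: eqVneq => [->//|iq].
  exact: HC.
transitivity (P (\bigcap_i (Y i @^-1` B i))) => //.
rewrite YE (prob_pair_event _ _ _ k0 kfin)//; last 2 first.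
  move=> A D mA mD.
  pose B' i := if i == p then A else if i == q then D else B i.
  have mB' i : measurable (B' i) by rewrite /B'; case: ifP => // _; case: ifP.
  have -> : X p @^-1` A `&` X q @^-1` D `&` C = \bigcap_i (X i @^-1` B' i).
    apply/seteqP; split => w.
      move=> [[/= Hp Hq] HC] i _; rewrite /B' /=.
      case: eqVneq => [->//|ip]; case: eqVneq => [->//|iq].
      exact: HC.
    move=> H; split; first split.
    - by have := H p Logic.I; rewrite /B' eqxx.
    - by have := H q Logic.I; rewrite /B' eqxx eq_sym (negbTE pq).
    - move=> i [ip iq]; have := H i Logic.I.
      by rewrite /B' /= (negbTE ip) (negbTE iq).
  rewrite XE// (bigD1 p)//= (bigD1 q)//=; last by rewrite eq_sym.
  rewrite muleA muleC /B' eqxx eq_sym (negbTE pq) eqxx; congr (_ * _)%E.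
  by apply: eq_bigr => i /andP[/negbTE -> /negbTE ->].
- apply: measurable_preimageT.
  apply/measurable_fun_pairP; split => /=.
    by apply: measurable_funD; apply: measurable_funM.
  by apply: measurable_funB; apply: measurable_funM.
- exact: measurableX.
rewrite normal_prob_rotation//.
rewrite [RHS](bigD1 p)//= (bigD1 q)//=; last by rewrite eq_sym.
by rewrite muleA muleC.
Qed.

End iid_gaussian.

(** * Orthogonal matrices built from plane rotations *)

Section gaussian_preserving.
Context {R : realType} {d : measure_display} {T : measurableType d}.
Variable P : probability T R.

(** Invariance is carried as a property beside orthogonality, since it is established for products
    of the plane rotations below. [K] indexes columns on which [Q] acts simultaneously: a single one
    for a vector, all of them for a matrix. *)
Definition gaussian_preserving n (Q : 'M[R]_n) :=
  Q^T *m Q = 1%:M /\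
  forall (K : finType) (X : 'I_n * K -> T -> R), iid_gaussian P X ->
    iid_gaussian P (fun ik w => \sum_j Q ik.1 j * X (j, ik.2) w).

Lemma gaussian_preserving1 n : gaussian_preserving (1%:M : 'M[R]_n).
Proof.
split=> [|K X XE]; first by rewrite trmx1 mul1mx.
rewrite (_ : (fun _ => _) = X)//; apply/funext => -[i k]; apply/funext => w /=.
rewrite (bigD1 i)//= big1 ?addr0 ?mxE ?eqxx ?mul1r// => j ji.
by rewrite mxE eq_sym (negbTE ji) mul0r.
Qed.

Lemma gaussian_preservingM n (Q1 Q2 : 'M[R]_n) :
  gaussian_preserving Q1 -> gaussian_preserving Q2 ->
  gaussian_preserving (Q1 *m Q2).
Proof.
move=> [e1 g1] [e2 g2]; split=> [|K X XE].
  by rewrite trmx_mul mulmxA -(mulmxA Q2^T) e1 mulmx1.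
have := g1 _ _ (g2 _ _ XE); congr (iid_gaussian P).
apply/funext => -[i k]; apply/funext => w /=.
under eq_bigr do rewrite mulr_sumr.
rewrite exchange_big/=; apply: eq_bigr => j _.
by rewrite mxE mulr_suml; apply: eq_bigr => l _; rewrite mulrA.
Qed.

Definition givens n (p q : 'I_n) (c s : R) : 'M[R]_n :=
  \matrix_(i, j) if i == p then c * (p == j)%:R + s * (q == j)%:R
    else if i == q then c * (q == j)%:R - s * (p == j)%:R else (i == j)%:R.

Lemma sum_delta n (p : 'I_n) (x : 'I_n -> R) : \sum_j (p == j)%:R * x j = x p.
Proof.
rewrite (bigD1 p)//= eqxx mul1r big1 ?addr0// => j jp.
by rewrite eq_sym (negbTE jp) mul0r.
Qed.

Lemma givensE n (p q : 'I_n) (c s : R) i (x : 'I_n -> R) :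
  \sum_j givens p q c s i j * x j =
    if i == p then c * x p + s * x q
    else if i == q then c * x q - s * x p else x i.
Proof.
under eq_bigr do rewrite mxE.
case: (i == p).
  under eq_bigr do rewrite mulrDl -!mulrA.
  by rewrite big_split/= -!mulr_sumr !sum_delta.
case: (i == q); last exact: sum_delta.
under eq_bigr do rewrite mulrBl -!mulrA.
by rewrite sumrB -!mulr_sumr !sum_delta.
Qed.

Lemma givens_orthogonal n (p q : 'I_n) (c s : R) : p != q ->
  c ^+ 2 + s ^+ 2 = 1 -> (givens p q c s)^T *m givens p q c s = 1%:M.
Proof.
move=> pq cs1; apply/matrixP => i j; rewrite !mxE.
rewrite -(sum_delta i (fun k => (k == j)%:R)).
rewrite [RHS](bigD1 p)//= [X in _ = _ + X](bigD1 q)//=; last by rewrite eq_sym.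
rewrite (bigD1 p)//= [X in _ + X = _](bigD1 q)//=; last by rewrite eq_sym.
rewrite !addrA; congr (_ + _).
  rewrite !mxE !eqxx [q == p]eq_sym (negbTE pq) ![i == _]eq_sym.
  transitivity ((c ^+ 2 + s ^+ 2) *
    ((p == i)%:R * (p == j)%:R + (q == i)%:R * (q == j)%:R : R)); first by ring.
  by rewrite cs1 mul1r.
apply: eq_bigr => k /andP[kp kq].
by rewrite !mxE (negbTE kp) (negbTE kq) [i == k]eq_sym.
Qed.

Lemma gaussian_preserving_givens n (p q : 'I_n) (c s : R) : p != q -> 0 < c ->
  c ^+ 2 + s ^+ 2 = 1 -> gaussian_preserving (givens p q c s).
Proof.
move=> pq c0 cs1; split=> [|K X XE]; first exact: givens_orthogonal.
(* The columns are rotated one at a time; [r] lists those already done. *)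
pose Y (r : seq K) (ik : 'I_n * K) w := if ik.2 \in r then
  if ik.1 == p then c * X (p, ik.2) w + s * X (q, ik.2) w
  else if ik.1 == q then c * X (q, ik.2) w - s * X (p, ik.2) w
  else X ik w else X ik w.
have YE r : uniq r -> iid_gaussian P (Y r).
  elim: r => [|k r IHr] /=; first by move=> _.
  move=> /andP[kr ur].
  have pkqk : (p, k) != (q, k) by rewrite xpair_eqE negb_and pq.
  have := iid_gaussian_rotation pkqk c0 cs1 (IHr ur); congr (iid_gaussian P).
  apply/funext => -[i l]; apply/funext => w.
  rewrite /Y /= !xpair_eqE in_cons (negbTE kr).
  by have [->|lk] := eqVneq l k; rewrite ?(negbTE kr) ?andbT ?andbF.
have := YE (enum K) (enum_uniq _); congr (iid_gaussian P).
apply/funext => -[i l]; apply/funext => w.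
by rewrite /Y /= mem_enum/= (givensE _ _ _ _ _ (fun j => X (j, l) w)).
Qed.

(** Givens elimination: each other coordinate is rotated into coordinate [m]. That coordinate starts
    positive and stays so, which keeps every cosine [a / rr] positive, as [normal_prob_rotation]
    demands. Orthogonality identifies the final entry as the norm of [u]. *)
Lemma exists_gaussian_preserving n (u : 'cV[R]_n) (m : 'I_n) :
  0 < u m ord0 ->
  exists2 Q, gaussian_preserving Q &
    Q *m u = Num.sqrt (\sum_i u i ord0 ^+ 2) *: delta_mx m ord0.
Proof.
move=> um.
have [Q gQ [Qm Q0]] : exists2 Q, gaussian_preserving Q &
    0 < (Q *m u) m ord0 /\
    (forall i, i \in enum 'I_n -> i != m -> (Q *m u) i ord0 = 0).
  elim: (enum 'I_n) => [|q r [Q gQ [Qm Q0]]].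
    by exists 1%:M; [exact: gaussian_preserving1|rewrite mul1mx].
  have [qm|qm] := eqVneq q m.
    exists Q => //; split => // i; rewrite in_cons qm => /orP[/eqP ->|].
      by rewrite eqxx.
    exact: Q0.
  pose a := (Q *m u) m ord0; pose b := (Q *m u) q ord0.
  pose rr := Num.sqrt (a ^+ 2 + b ^+ 2).
  have rr2 : rr ^+ 2 = a ^+ 2 + b ^+ 2 by rewrite sqr_sqrtr// addr_ge0 ?sqr_ge0.
  have rr0 : 0 < rr by rewrite sqrtr_gt0 ltr_pwDl ?sqr_ge0// exprn_gt0.
  exists (givens m q (a / rr) (b / rr) *m Q).
    apply: gaussian_preservingM => //; apply: gaussian_preserving_givens.
    - by rewrite eq_sym.
    - by rewrite divr_gt0.
    - by rewrite !expr_div_n -mulrDl -rr2 divff// sqrf_eq0 gt_eqF.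
  have E i : (givens m q (a / rr) (b / rr) *m Q *m u) i ord0 =
      if i == m then rr else if i == q then 0 else (Q *m u) i ord0.
    rewrite -mulmxA mxE givensE -/a -/b.
    case: (i == m).
      transitivity ((a ^+ 2 + b ^+ 2) / rr); first by ring.
      by rewrite -rr2 expr2 mulfK// gt_eqF.
    by case: (i == q) => //; ring.
  split; first by rewrite E eqxx.
  move=> i; rewrite in_cons E => /orP[/eqP ->|ir] im.
    by rewrite (negbTE im) eqxx.
  by rewrite (negbTE im); case: eqP => // _; exact: Q0.
exists Q => //.
have E : Q *m u = (Q *m u) m ord0 *: delta_mx m ord0.
  apply/matrixP => i j; rewrite ord1 [RHS]mxE [delta_mx _ _ _ _]mxE.
  have [->|im] := eqVneq i m; first by rewrite mulr1.
  by rewrite mulr0; apply: Q0; rewrite ?mem_enum.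
rewrite {}E; congr (_ *: _).
have -> : \sum_i u i ord0 ^+ 2 = (u^T *m u) ord0 ord0.
  by rewrite mxE; apply: eq_bigr => i _; rewrite !mxE expr2.
have -> : u^T *m u = (Q *m u)^T *m (Q *m u).
  by rewrite trmx_mul mulmxA -(mulmxA u^T) gQ.1 mulmx1.
rewrite [in RHS]mxE (bigD1 m)//= big1 ?addr0; last first.
  by move=> i im; rewrite [X in _ * X](Q0 i)// ?mem_enum// mulr0.
by rewrite [X in X * _]mxE -expr2 sqrtr_sqr gtr0_norm.
Qed.

End gaussian_preserving.

(** * Joint laws of finite families and independence of blocks *)

Section tuple_law.
Context {R : realType} {d : measure_display} {T : measurableType d}.

Definition tuple_box n (B : 'I_n -> set R) : set (n.-tuple R) :=
  [set t | forall i, B i (tnth t i)].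

Lemma tuple_boxE n (B : 'I_n -> set R) :
  tuple_box B = \bigcap_i ((fun t => tnth t i) @^-1` B i).
Proof. by apply/seteqP; split => t H i; [move=> _; exact: H|exact: (H i Logic.I)]. Qed.

Lemma measurable_tuple_box n (B : 'I_n -> set R) :
  (forall i, measurable (B i)) -> measurable (tuple_box B).
Proof.
move=> mB; rewrite tuple_boxE; apply: fin_bigcap_measurable => [|i _].
  exact: finite_finset.
by apply: measurable_preimageT => //; exact: measurable_tnth.
Qed.

(** Boxes are stable under intersection and generate the sigma-algebra, since a box may constrain a
    single coordinate. *)
Lemma measure_tuple_unique n
    (m1 m2 : {measure set (n.-tuple R) -> \bar R}) : (m1 setT < +oo)%E ->
  (forall B, (forall i, measurable (B i)) -> m1 (tuple_box B) = m2 (tuple_box B)) ->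
  forall S, measurable S -> m1 S = m2 S.
Proof.
move=> m1T m12 S mS.
pose G := [set tuple_box B | B in [set B : 'I_n -> set R | forall i, measurable (B i)]].
have GT : G setT.
  by exists (fun=> setT) => //; apply/seteqP; split => // t _ i.
apply: (measure_unique G (fun=> setT)) => //.
- apply/seteqP; split; last first.
    apply: smallest_sub; first exact: sigma_algebra_measurable.
    by move=> _ [B mB <-]; exact: measurable_tuple_box.
  apply: smallest_sub; first exact: smallest_sigma_algebra.
  move=> A; rewrite -bigcup_seq => -[i _ [B mB <-]].
  apply: sub_sigma_algebra; exists (fun j => if j == i then B else setT).
    by move=> j /=; case: ifP.
  rewrite setTI; apply/seteqP; split => t /= H.
    by have := H i; rewrite eqxx.
  by move=> j; case: eqP => // ->.
- move=> _ _ [A mA <-] [B mB <-]; exists (fun i => A i `&` B i).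
    by move=> i; exact: measurableI.
  by apply/seteqP; split => t; [move=> H; split => i; case: (H i)|move=> [HA HB] i].
- by apply/seteqP; split => // t _; exists 0%N.
- by move=> _ [B mB <-]; exact: m12.
Qed.

(** Listing a family along the enumeration of its index type makes it a random element of a space of
    tuples, on which product measures can be formed. *)
Definition tuple_of_family (I : finType) (X : I -> T -> R) (w : T) :
  #|I|.-tuple R := [tuple X (enum_val i) w | i < #|I|].

Lemma tnth_tuple_of_family (I : finType) (X : I -> T -> R) w i :
  tnth (tuple_of_family X w) (enum_rank i) = X i w.
Proof. by rewrite tnth_mktuple enum_rankK. Qed.

Lemma measurable_tuple_of_family (I : finType) (X : I -> T -> R) :
  (forall i, measurable_fun [set: T] (X i)) ->
  measurable_fun [set: T] (tuple_of_family X).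
Proof.
move=> mX; apply/measurable_fun_tnthP => i.
rewrite (_ : _ \o _ = X (enum_val i)); first exact: mX.
by apply/funext => w /=; rewrite tnth_mktuple.
Qed.

Variable P : probability T R.

(** With [C] fixed, both sides are finite measures in [A], so it suffices to compare them on
    boxes. *)
Lemma tuple_of_family_indep_event (I : finType) (X : I -> T -> R) (C : set T) :
  (forall i, measurable_fun [set: T] (X i)) -> measurable C ->
  (forall B : I -> set R, (forall i, measurable (B i)) ->
    P (\bigcap_i (X i @^-1` B i) `&` C) =
    (P (\bigcap_i (X i @^-1` B i)) * P C)%E) ->
  forall A, measurable A ->
    P (tuple_of_family X @^-1` A `&` C) =
    (P (tuple_of_family X @^-1` A) * P C)%E.
Proof.
move=> mX mC PXC A mA.
have mU := measurable_tuple_of_family mX.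
set U := tuple_of_family X.
have PC0 : 0 <= fine (P C) by rewrite fine_ge0.
pose Um : {mfun T >-> #|I|.-tuple R} := HB.pack U (isMeasurableFun.Build _ _ _ _ _ mU).
pose m1' : {measure set _ -> \bar R} := pushforward (mrestr P mC) Um.
pose m1 := m1' mU.
pose m2 : {measure set (#|I|.-tuple R) -> \bar R} :=
  mscale (NngNum PC0) (distribution P Um).
transitivity (m1 A); first by [].
transitivity (m2 A); last by rewrite /m2 /= /mscale /= fineK ?fin_num_measure// muleC.
apply: (@measure_tuple_unique _ m1 m2) => [|B mB|]; last exact: mA.
  rewrite /m1 /m1' /= /pushforward /mrestr preimage_setT setTI.
  by rewrite -ge0_fin_numE// fin_num_measure.
transitivity (P (U @^-1` tuple_box B `&` C)) => //.
transitivity ((fine (P C))%:E * P (U @^-1` tuple_box B))%E => //.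
have -> : U @^-1` tuple_box B = \bigcap_i (X i @^-1` B (enum_rank i)).
  apply/seteqP; split => w H.
    by move=> i _; have := H (enum_rank i); rewrite tnth_tuple_of_family.
  by move=> i; have := H (enum_val i) Logic.I; rewrite /= enum_valK tnth_mktuple.
by rewrite PXC// fineK ?fin_num_measure// muleC.
Qed.

(** Boxes are replaced by measurable sets one block at a time, the other block being held fixed as
    the event [C] of the preceding lemma. *)
Lemma iid_gaussian_split (I J : finType) (X : I + J -> T -> R) :
  iid_gaussian P X ->
  forall A B, measurable A -> measurable B ->
  P (tuple_of_family (X \o inl) @^-1` A `&` tuple_of_family (X \o inr) @^-1` B) =
  (P (tuple_of_family (X \o inl) @^-1` A) *
   P (tuple_of_family (X \o inr) @^-1` B))%E.
Proof.
move=> XX A B mA mB; have [mX XE] := XX.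
have [mXl XEl] : iid_gaussian P (X \o inl).
  by apply: iid_gaussian_comp => // x y [].
have [mXr XEr] : iid_gaussian P (X \o inr).
  by apply: iid_gaussian_comp => // x y [].
have mbox (K : finType) (Y : K -> T -> R) (D : K -> set R) :
    (forall i, measurable_fun [set: T] (Y i)) -> (forall i, measurable (D i)) ->
    measurable (\bigcap_i (Y i @^-1` D i)).
  move=> mY mD; apply: fin_bigcap_measurable => [|i _]; first exact: finite_finset.
  exact: measurable_preimageT.
rewrite setIC muleC; apply: tuple_of_family_indep_event => // [|D mD].
  by apply: measurable_preimageT => //; exact: measurable_tuple_of_family.
rewrite setIC muleC; apply: tuple_of_family_indep_event => // [|E mE].
  exact: mbox.
pose F k := match k with inl i => E i | inr j => D j end.
have mF k : measurable (F k) by case: k.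
transitivity (P (\bigcap_k (X k @^-1` F k))); last first.
  by rewrite XE// big_sumType/= XEl// XEr.
congr (P _).
apply/seteqP; split => w; first by move=> [Hl Hr] [i|j] _; [exact: Hl|exact: Hr].
by move=> H; split => k _; [exact: (H (inl k))|exact: (H (inr k))].
Qed.

Lemma ge0_integral_indep d1 d2 (T1 : measurableType d1) (T2 : measurableType d2)
    (U : T -> T1) (V : T -> T2) (F : T1 * T2 -> \bar R) :
  measurable_fun [set: T] U -> measurable_fun [set: T] V ->
  (forall A B, measurable A -> measurable B ->
    P (U @^-1` A `&` V @^-1` B) = (P (U @^-1` A) * P (V @^-1` B))%E) ->
  measurable_fun [set: T1 * T2] F -> (forall z, 0 <= F z)%E ->
  (\int[P]_w F (U w, V w) = \int[P]_w' \int[P]_w F (U w, V w'))%E.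
Proof.
move=> mU mV UV mF F0.
pose Um : {mfun T >-> T1} := HB.pack U (isMeasurableFun.Build _ _ _ _ _ mU).
pose Vm : {mfun T >-> T2} := HB.pack V (isMeasurableFun.Build _ _ _ _ _ mV).
pose UV_ w := (U w, V w).
have mUV : measurable_fun [set: T] UV_ by exact: measurable_fun_pair.
pose W : {mfun T >-> (T1 * T2)%type} := HB.pack UV_ (isMeasurableFun.Build _ _ _ _ _ mUV).
transitivity (\int[distribution P W]_z F z)%E.
  by rewrite ge0_integral_distribution.
transitivity (\int[distribution P Um \x distribution P Vm]_z F z)%E.
  apply: eq_measure_integral => S mS _; apply/esym.
  by apply: product_measure_unique => // A B mA mB; exact: UV.
rewrite fubini_tonelli2// ge0_integral_distribution//=; last 2 first.
- exact: measurable_fun_fubini_tonelli_G.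
- by move=> y; exact: integral_ge0.
apply: eq_integral => w' _.
rewrite /fubini_G /= ge0_integral_distribution//.
exact: measurableT_comp.
Qed.

(** This is conditioning on [V]: a bound valid for every frozen value of [V] is integrated against
    its law. The product measure is taken in the form that integrates sections with the second
    variable fixed. *)
Lemma prob_indep_le d1 d2 (T1 : measurableType d1) (T2 : measurableType d2)
    (U : T -> T1) (V : T -> T2) (S : set (T1 * T2)) (e : R) :
  measurable_fun [set: T] U -> measurable_fun [set: T] V ->
  (forall A B, measurable A -> measurable B ->
    P (U @^-1` A `&` V @^-1` B) = (P (U @^-1` A) * P (V @^-1` B))%E) ->
  measurable S -> 0 <= e ->
  (forall v, (P [set w | S (U w, v)] <= e%:E)%E) ->
  (P ((fun w => (U w, V w)) @^-1` S) <= e%:E)%E.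
Proof.
move=> mU mV UV mS e0 Se.
pose Um : {mfun T >-> T1} := HB.pack U (isMeasurableFun.Build _ _ _ _ _ mU).
pose Vm : {mfun T >-> T2} := HB.pack V (isMeasurableFun.Build _ _ _ _ _ mV).
pose UV_ w := (U w, V w).
have mUV : measurable_fun [set: T] UV_ by exact: measurable_fun_pair.
pose W : {mfun T >-> (T1 * T2)%type} := HB.pack UV_ (isMeasurableFun.Build _ _ _ _ _ mUV).
have -> : P (UV_ @^-1` S) = (distribution P Um \x^ distribution P Vm)%E S.
  transitivity ((distribution P Um \x distribution P Vm)%E S).
    by apply/esym/(product_measure_unique (m' := distribution P W)).
  apply: product_measure_unique => // A B mA mB.
  exact: product_measure2E.
rewrite /product_measure2.
apply: (@le_trans _ _ (\int[distribution P Vm]_v (cst e%:E v))%E).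
  apply: ge0_le_integral => //.
  - exact: measurable_fun_ysection.
  - move=> v _; rewrite /= /distribution /pushforward.
    rewrite (_ : _ @^-1` _ = [set w | S (U w, v)])//.
    by apply/seteqP; split => w; rewrite /ysection /= inE.
rewrite integral_cst// -[leRHS]mule1; apply: lee_wpmul2l; first by rewrite lee_fin.
exact: probability_le1.
Qed.

End tuple_law.

(** * Exponential moments and small ball estimates *)

Section gaussian_estimates.
Context {R : realType} {d : measure_display} {T : measurableType d}.
Variable P : probability T R.
Local Notation N := (@normal_prob R 0 1).
Local Notation mu := (@lebesgue_measure R).

Lemma iid_gaussian_law (I : finType) (X : I -> T -> R) i (B : set R) :
  iid_gaussian P X -> measurable B -> P (X i @^-1` B) = N B.
Proof.
move=> [mX XE] mB.
have mB' j : measurable (if j == i then B else setT : set R) by case: ifP.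
transitivity (P (\bigcap_j (X j @^-1` (if j == i then B else setT)))).
  congr (P _); apply/seteqP; split => w H.
    by move=> j _; case: eqP => // ->.
  by have := H i Logic.I; rewrite eqxx.
rewrite XE// (bigD1 i)//= eqxx big1 ?mule1// => j /negbTE ->.
exact: probability_setT.
Qed.

Lemma ge0_integral_iid_gaussian (I : finType) (X : I -> T -> R) i (f : R -> \bar R) :
  iid_gaussian P X -> measurable_fun [set: R] f -> (forall x, 0 <= f x)%E ->
  (\int[P]_w f (X i w) = \int[mu]_x (f x * (normal_pdf 0 1 x)%:E))%E.
Proof.
move=> XX mf f0; have [mX _] := XX.
rewrite -ge0_integral_normal_prob//.
have mXi : measurable_fun [set: T] (X i : T -> measurableTypeR R) by exact: mX.
pose Xm : {mfun T >-> measurableTypeR R} :=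
  HB.pack (X i : T -> measurableTypeR R) (isMeasurableFun.Build _ _ _ _ _ mXi).
transitivity (\int[distribution P Xm]_x f x)%E.
  by rewrite ge0_integral_distribution.
by apply: eq_measure_integral => A mA _; exact: (iid_gaussian_law _ XX).
Qed.

(** Multiplying the standard density by exp(x^2/4) leaves exp(-x^2/4), which is sqrt 2 times the
    density of variance 2. *)
Lemma integral_expR_sqr_gaussian (I : finType) (X : I -> T -> R) i :
  iid_gaussian P X ->
  (\int[P]_w (expR (X i w ^+ 2 / 4))%:E = (Num.sqrt 2)%:E)%E.
Proof.
move=> XX.
rewrite (@ge0_integral_iid_gaussian _ X i
  (fun x => (expR (x ^+ 2 / 4))%:E))//; last first.
  apply/measurable_EFinP; apply: measurableT_comp => //.
  by apply: measurable_funM => //; exact: measurable_funX.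
have s2 : Num.sqrt 2 != 0 :> R by rewrite gt_eqF// sqrtr_gt0.
transitivity (\int[mu]_x ((Num.sqrt 2)%:E * (normal_pdf 0 (Num.sqrt 2) x)%:E))%E.
  apply: eq_integral => x _; rewrite -!EFinM; congr (_%:E).
  rewrite !normal_pdfE ?oner_neq0// /normal_peak /normal_fun !subr0.
  rewrite mulrCA -expRD mulrA; congr (_ * expR _).
    rewrite expr1n mul1r sqr_sqrtr ?ler0n// -mulrnAr sqrtrM ?ler0n//.
    by rewrite invfM mulrA divff// mul1r.
  by rewrite sqr_sqrtr ?ler0n// expr1n -[2 *+ 2]mulr_natl; field.
rewrite ge0_integralZl//; last 2 first.
- by apply/measurable_EFinP; exact: measurable_normal_pdf.
- by move=> x _; rewrite lee_fin normal_pdf_ge0.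
by rewrite integral_normal_pdf mule1.
Qed.

Lemma integral_expR_sum_sqr_gaussian n (X : 'I_n -> T -> R) :
  iid_gaussian P X ->
  (\int[P]_w (expR ((\sum_i X i w ^+ 2) / 4))%:E = (Num.sqrt 2 ^+ n)%:E)%E.
Proof.
elim: n X => [|n IHn] X XX.
  under eq_integral do rewrite big_ord0 mul0r expR0.
  rewrite (integral_cst P measurableT 1%:E) mul1e; exact: probability_setT.
pose h (k : unit + 'I_n) := if k is inr i then lift ord0 i else ord0.
have injh : injective h.
  by move=> [[]|i] [[]|j] //= /eqP; rewrite ?(inj_eq lift_inj)// => /eqP ->.
have XhX := iid_gaussian_comp injh XX.
have [mXh _] := XhX.
pose U := tuple_of_family ((X \o h) \o inl).
pose V := tuple_of_family ((X \o h) \o inr).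
pose F (z : #|{: unit}|.-tuple R * #|'I_n|.-tuple R) : \bar R :=
  ((expR (tnth z.1 (enum_rank tt) ^+ 2 / 4))%:E *
   (expR ((\sum_i tnth z.2 (enum_rank i) ^+ 2) / 4))%:E)%E.
have FE w w' : F (U w, V w') = ((expR (X ord0 w ^+ 2 / 4))%:E *
    (expR ((\sum_i X (lift ord0 i) w' ^+ 2) / 4))%:E)%E.
  have Uw : tnth (U w) (enum_rank tt) = X ord0 w.
    exact: (tnth_tuple_of_family ((X \o h) \o inl) w tt).
  have Vw i : tnth (V w') (enum_rank i) = X (lift ord0 i) w'.
    exact: (tnth_tuple_of_family ((X \o h) \o inr) w' i).
  rewrite /F [(U w, V w').1]/= [(U w, V w').2]/= Uw.
  by under eq_bigr do rewrite Vw.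
transitivity (\int[P]_w F (U w, V w))%E.
  apply: eq_integral => w _.
  by rewrite FE -EFinM -expRD -mulrDl big_ord_recl.
rewrite ge0_integral_indep; last 5 first.
- by apply: measurable_tuple_of_family => i; exact: mXh.
- by apply: measurable_tuple_of_family => i; exact: mXh.
- exact: iid_gaussian_split.
- apply/measurable_EFinP; apply: measurable_funM.
    apply: measurableT_comp => //; apply: measurable_funM => //.
    by apply: measurable_funX; apply: (measurableT_comp (measurable_tnth _)).
  apply: measurableT_comp => //; apply: measurable_funM => //.
  apply: measurable_sum => i; apply: measurable_funX.
  exact: (measurableT_comp (measurable_tnth _)).
- by move=> z; rewrite mule_ge0// lee_fin expR_ge0.
have iidS : iid_gaussian P (fun i => X (lift ord0 i)).
  by apply: (iid_gaussian_comp (h := lift ord0)) => //; exact: lift_inj.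
have [mS _] := iidS; have [mX _] := XX.
have mexp (f : T -> R) : measurable_fun setT f ->
    measurable_fun setT (fun w => (expR (f w / 4))%:E).
  move=> mf; apply/measurable_EFinP; apply: measurableT_comp => //.
  exact: measurable_funM.
transitivity (\int[P]_w' ((Num.sqrt 2)%:E *
    (expR ((\sum_i X (lift ord0 i) w' ^+ 2) / 4))%:E))%E.
  apply: eq_integral => w' _.
  under eq_integral do rewrite FE.
  rewrite ge0_integralZr//; last first.
    by apply: mexp; exact: measurable_funX.
  by rewrite integral_expR_sqr_gaussian.
rewrite ge0_integralZl//; last first.
- by apply: mexp; apply: measurable_sum => i; exact: measurable_funX.
by rewrite IHn// -EFinM -exprS.
Qed.

(** The interval has length [2 a], and the density is at most 1/2 because sqrt(2 pi) is at least
    2. *)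
Lemma normal_prob_itv_le (a : R) : 0 <= a -> (N (`[- a, a]%classic)%R <= a%:E)%E.
Proof.
move=> a0; rewrite /normal_prob; pose D : set R := `[- a, a]%classic.
rewrite -/D.
apply: (@le_trans _ _ (\int[mu]_(x in D) (2^-1)%:E)%E).
  apply: ge0_le_integral => //=.
  - exact: measurable_itv.
  - by move=> x _; rewrite lee_fin normal_pdf_ge0.
  - by apply/measurable_EFinP/measurable_funTS; exact: measurable_normal_pdf.
  - move=> x _; rewrite lee_fin (le_trans (normal_pdf_ub _ _ (oner_neq0 _)))//.
    rewrite /normal_peak lef_pV2 ?posrE ?sqrtr_gt0//; last first.
      by rewrite mulrn_wgt0// mulr_gt0 ?pi_gt0// exprn_gt0.
    have -> : 2 = Num.sqrt (2 ^+ 2) :> R by rewrite sqrtr_sqr ger0_norm.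
    rewrite ler_wsqrtr// expr1n mul1r.
    by have := pi_ge2 R; lra.
rewrite integral_cst//=; last exact: measurable_itv.
rewrite /D lebesgue_measure_itv/= lte_fin.
case: ifPn => _; last by rewrite mule0 lee_fin.
by rewrite -EFinB -EFinM lee_fin; lra.
Qed.

(** A rotation taking [a] to |a| times a basis vector exhibits the linear form as |a| times one
    standard normal variable. Passing from [a] to [- a] provides the positive coordinate that this
    rotation starts from. *)
Lemma gaussian_linear_small_ball n (X : 'I_n -> T -> R) (a : 'I_n -> R) (e : R) :
  iid_gaussian P X -> 0 <= e -> \sum_i a i ^+ 2 != 0 ->
  (P [set w | `|\sum_i a i * X i w| <= e * Num.sqrt (\sum_i a i ^+ 2)]%R <= e%:E)%E.
Proof.
move=> XX e0 a0.
wlog [m am] : a a0 / exists m, 0 < a m.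
  move=> H; have [m am] : exists m, a m != 0.
    apply/existsP; apply: contraNT a0 => /existsPn am.
    rewrite big1// => i _; apply/eqP; rewrite sqrf_eq0.
    by have := am i; rewrite negbK.
  have [am0|am0] := ltP 0 (a m); first by apply: H => //; exists m.
  have aN : \sum_i (- a i) ^+ 2 = \sum_i a i ^+ 2.
    by apply: eq_bigr => i _; rewrite sqrrN.
  have := H (fun i => - a i); rewrite aN => /(_ a0).
  have -> : [set w | `|\sum_i - a i * X i w| <= e * Num.sqrt (\sum_i a i ^+ 2)] =
     [set w | `|\sum_i a i * X i w| <= e * Num.sqrt (\sum_i a i ^+ 2)].
    have E w : \sum_i - a i * X i w = - \sum_i a i * X i w.
      by rewrite -sumrN; apply: eq_bigr => i _; rewrite mulNr.
    by apply/seteqP; split => w /=; rewrite E normrN.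
  by apply; exists m; rewrite oppr_gt0 lt_neqAle am am0.
pose u : 'cV[R]_n := \col_i a i.
have um : 0 < u m ord0 by rewrite mxE.
have [Q [QQ gQ] Qu] := exists_gaussian_preserving P um.
pose h (k : 'I_n * unit) := k.1.
have injh : injective h by move=> [i []] [j []] /= ->.
have YY := gQ _ _ (iid_gaussian_comp injh XX).
set r := Num.sqrt _ in Qu.
have -> : Num.sqrt (\sum_i a i ^+ 2) = r.
  by congr Num.sqrt; apply: eq_bigr => i _; rewrite mxE.
have r0 : 0 < r.
  rewrite sqrtr_gt0 lt_neqAle eq_sym sumr_ge0 ?andbT; last by move=> *; exact: sqr_ge0.
  by rewrite (eq_bigr (fun i => a i ^+ 2))// => i _; rewrite mxE.
have aE i : a i = r * Q m i.
  have -> : a i = (Q^T *m (Q *m u)) i ord0 by rewrite mulmxA QQ mul1mx mxE.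
  rewrite Qu -scalemxAr [LHS]mxE; congr (_ * _).
  rewrite mxE (bigD1 m)//= big1 ?addr0; first by rewrite !mxE !eqxx mulr1.
  by move=> j jm; rewrite !mxE (negbTE jm) mulr0.
pose Y w := \sum_j Q m j * X j w.
have -> : [set w | `|\sum_i a i * X i w| <= e * r] = Y @^-1` `[(- e), e]%classic.
  have E w : \sum_i a i * X i w = r * Y w.
    by rewrite mulr_sumr; apply: eq_bigr => i _; rewrite aE mulrA.
  apply/seteqP; split => w /=; rewrite in_itv /= -ler_norml E;
  by rewrite normrM (gtr0_norm r0) mulrC ler_pM2r.
apply: le_trans (normal_prob_itv_le e0).
by rewrite -(iid_gaussian_law (m, tt) YY).
Qed.

End gaussian_estimates.

(** * Inverses of square Gaussian matrices *)

Section random_matrix_inverse.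
Context {R : realType}.

Lemma measurable_set_bool d (S : measurableType d) (b : S -> bool) :
  measurable_fun [set: S] b -> measurable [set x | b x].
Proof.
move=> mb; have -> : [set x | b x] = b @^-1` [set true].
  by apply/seteqP; split => x.
exact: measurable_preimageT.
Qed.

Lemma measurable_det d (S : measurableType d) n (B : 'I_n -> 'I_n -> S -> R) :
  (forall i j, measurable_fun [set: S] (B i j)) ->
  measurable_fun [set: S] (fun s => \det (\matrix_(i, j) B i j s)).
Proof.
move=> mB; apply: measurable_sum => p; apply: measurable_funM => //.
have -> : (fun x => \prod_i (\matrix_(i, j) B i j x) i (p i)) =
    (fun x => \prod_i B i (p i) x).
  by apply/funext => x; apply: eq_bigr => i _; rewrite mxE.
exact: measurable_prod.
Qed.

Lemma cofactorE n (B : 'I_n.+1 -> 'I_n.+1 -> R) m j :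
  cofactor (\matrix_(i, j) B i j) m j =
  (-1) ^+ (m + j) * \det (\matrix_(i, k) B (lift m i) (lift j k)).
Proof.
rewrite /cofactor; congr (_ * \det _).
by apply/matrixP => i k; rewrite !mxE.
Qed.

Context {d : measure_display} {T : measurableType d}.
Variable P : probability T R.

Definition matrix_of_family n k (A : 'I_n * 'I_k -> T -> R) w : 'M[R]_(n, k) :=
  \matrix_(i, j) A (i, j) w.

Lemma measurable_cofactor n (A : 'I_n.+1 * 'I_n.+1 -> T -> R) m j :
  (forall ij, measurable_fun [set: T] (A ij)) ->
  measurable_fun [set: T] (fun w => cofactor (matrix_of_family A w) m j).
Proof.
move=> mA.
have -> : (fun w => cofactor (matrix_of_family A w) m j) =
    (fun w => (-1) ^+ (m + j) * \det (\matrix_(i, k) A (lift m i, lift j k) w)).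
  by apply/funext => w; rewrite cofactorE.
by apply: measurable_funM => //; exact: measurable_det.
Qed.

(* The cofactors along a row do not depend on that row, and conditionally on
   them the determinant is a centred normal variable. *)
Lemma gaussian_det_small_ball n (A : 'I_n.+1 * 'I_n.+1 -> T -> R) m (e : R) :
  iid_gaussian P A -> 0 <= e ->
  (P [set w | (`|\det (matrix_of_family A w)| <=
      e * Num.sqrt (\sum_j cofactor (matrix_of_family A w) m j ^+ 2)) &&
      (\sum_j cofactor (matrix_of_family A w) m j ^+ 2 != 0)]%R <= e%:E)%E.
Proof.
move=> AA e0; set M := matrix_of_family A.
pose s w := \sum_j cofactor (M w) m j ^+ 2.
(* The left summand indexes row [m] and the right one all other rows, so that [iid_gaussian_split]
   separates the row from its cofactors. *)
pose h (k : 'I_n.+1 + 'I_n * 'I_n.+1) : 'I_n.+1 * 'I_n.+1 :=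
  match k with inl j => (m, j) | inr ij => (lift m ij.1, ij.2) end.
have injh : injective h.
  move=> [j|[i j]] [j'|[i' j']] /= /eqP; rewrite xpair_eqE => /andP[].
  - by move=> _ /eqP ->.
  - by rewrite (negbTE (neq_lift _ _)).
  - by rewrite eq_sym (negbTE (neq_lift _ _)).
  - by move=> /eqP/lift_inj -> /eqP ->.
have XX := iid_gaussian_comp injh AA.
have [mX _] := XX; have [mA _] := AA.
pose U := tuple_of_family ((A \o h) \o inl).
pose V := tuple_of_family ((A \o h) \o inr).
pose cof (t : #|{: 'I_n * 'I_n.+1}|.-tuple R) (j : 'I_n.+1) : R :=
  (-1) ^+ (m + j) * \det (\matrix_(i, k) tnth t (enum_rank (i, lift j k))).
pose sV t := \sum_j cof t j ^+ 2.
pose S : set (#|'I_n.+1|.-tuple R * #|{: 'I_n * 'I_n.+1}|.-tuple R) :=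
  [set z | (`|\sum_j cof z.2 j * tnth z.1 (enum_rank j)| <= e * Num.sqrt (sV z.2))
     && (sV z.2 != 0)].
have Uw w j : tnth (U w) (enum_rank j) = A (m, j) w.
  exact: (tnth_tuple_of_family ((A \o h) \o inl) w j).
have Vw w ij : tnth (V w) (enum_rank ij) = A (lift m ij.1, ij.2) w.
  exact: (tnth_tuple_of_family ((A \o h) \o inr) w ij).
have cofE w j : cof (V w) j = cofactor (M w) m j.
  rewrite cofactorE /cof; congr (_ * \det _).
  by apply/matrixP => i k; rewrite !mxE Vw.
have sVE w : sV (V w) = s w by apply: eq_bigr => j _; rewrite cofE.
have mcof j : measurable_fun setT (cof^~ j).
  apply: measurable_funM => //; apply: measurable_det => i k.
  exact: measurable_tnth.
have msV : measurable_fun setT sV.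
  by apply: measurable_sum => j; exact: measurable_funX.
have mS : measurable S.
  apply: measurable_set_bool; apply: measurable_and.
    apply: measurable_fun_ler.
      apply: measurableT_comp => //; apply: measurable_sum => j.
      apply: measurable_funM; first exact: (measurableT_comp (mcof j)).
      exact: (measurableT_comp (measurable_tnth _)).
    apply: measurable_funM; first exact: measurable_cst.
    apply: (@measurableT_comp _ _ _ _ _ _ (Num.sqrt : R -> R) _ (fun z => sV z.2)).
      by apply: continuous_measurable_fun; exact: sqrt_continuous.
    exact: (measurableT_comp msV).
  apply: measurable_neg.
  by apply: measurable_fun_eqr => //; exact: (measurableT_comp msV).
have mU : measurable_fun setT U.
  by apply: measurable_tuple_of_family => i; exact: mX.
have mV : measurable_fun setT V.
  by apply: measurable_tuple_of_family => i; exact: mX.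
have E : [set w | (`|\det (M w)| <= e * Num.sqrt (s w)) && (s w != 0)] =
    (fun w => (U w, V w)) @^-1` S.
  have detE w : \det (M w) = \sum_j cof (V w) j * tnth (U w) (enum_rank j).
    rewrite (expand_det_row _ m); apply: eq_bigr => j _.
    by rewrite cofE Uw mulrC mxE.
  by apply/seteqP; split => w; rewrite /S /= sVE detE.
rewrite [X in P X]E; apply: prob_indep_le => // [|v].
  exact: iid_gaussian_split.
have [sv0|sv0] := eqVneq (sV v) 0.
  rewrite [X in P X](_ : _ = set0) ?measure0 ?lee_fin//.
  by rewrite -subset0 => w; rewrite /S /= sv0 eqxx andbF.
have rowA : iid_gaussian P (fun j => A (m, j)).
  by apply: (iid_gaussian_comp (h := fun j => (m, j))) => // j j' [].
apply: le_trans (gaussian_linear_small_ball rowA e0 sv0).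
rewrite [X in (P X <= _)%E](_ : _ = [set w |
  `|\sum_i cof v i * A (m, i) w| <= e * Num.sqrt (\sum_i cof v i ^+ 2)])//.
have E' w : \sum_j cof v j * tnth (U w) (enum_rank j) = \sum_j cof v j * A (m, j) w.
  by apply: eq_bigr => j _; rewrite Uw.
by apply/seteqP; split => w; rewrite /S /= sv0 andbT E'.
Qed.

Lemma measurable_det_family n (A : 'I_n * 'I_n -> T -> R) :
  (forall ij, measurable_fun [set: T] (A ij)) ->
  measurable_fun [set: T] (fun w => \det (matrix_of_family A w)).
Proof. by move=> mA; exact: measurable_det. Qed.

Lemma measurable_sqrtr : measurable_fun [set: R] (Num.sqrt : R -> R).
Proof. by apply: continuous_measurable_fun; exact: sqrt_continuous. Qed.

Lemma measurable_gaussian_det_small_ball n (A : 'I_n.+1 * 'I_n.+1 -> T -> R) m (e : R) :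
  (forall ij, measurable_fun [set: T] (A ij)) ->
  measurable [set w | (`|\det (matrix_of_family A w)| <=
      e * Num.sqrt (\sum_j cofactor (matrix_of_family A w) m j ^+ 2)) &&
      (\sum_j cofactor (matrix_of_family A w) m j ^+ 2 != 0)].
Proof.
move=> mA; have ms : measurable_fun [set: T]
    (fun w => \sum_j cofactor (matrix_of_family A w) m j ^+ 2).
  by apply: measurable_sum => j; apply: measurable_funX; exact: measurable_cofactor.
apply: measurable_set_bool; apply: measurable_and.
  apply: measurable_fun_ler.
    by apply: measurableT_comp => //; exact: measurable_det_family.
  apply: measurable_funM; first exact: measurable_cst.
  exact: (measurableT_comp measurable_sqrtr).
by apply: measurable_neg; exact: measurable_fun_eqr.
Qed.

(** Induction on the size: almost surely the minor at (0, 0) is nonzero, so the cofactors of the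
    first row do not all vanish, and the small ball estimate at radius 0 applies. *)
Lemma gaussian_det_null n (A : 'I_n * 'I_n -> T -> R) :
  iid_gaussian P A -> P [set w | \det (matrix_of_family A w) == 0] = 0%E.
Proof.
elim: n A => [|n IHn] A AA.
  rewrite (_ : [set w | _] = set0) ?measure0// -subset0 => w /=.
  by rewrite det_mx00 oner_eq0.
have [mA _] := AA.
pose A' (ij : 'I_n * 'I_n) := A (lift ord0 ij.1, lift ord0 ij.2).
have AA' : iid_gaussian P A'.
  apply: (iid_gaussian_comp (h := fun ij => (lift ord0 ij.1, lift ord0 ij.2))) => //.
  by move=> [i j] [i' j'] /eqP; rewrite xpair_eqE => /andP[/eqP/lift_inj /= ->
    /eqP/lift_inj /= ->].
have [mA' _] := AA'.
pose N0 := [set w | \det (matrix_of_family A' w) == 0].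
have mN0 : measurable N0.
  apply: measurable_set_bool; apply: measurable_fun_eqr => //.
  exact: measurable_det_family.
set N1 := [set w | _].
have mN1 : measurable N1.
  apply: measurable_set_bool; apply: measurable_fun_eqr => //.
  exact: measurable_det_family.
pose S := [set w | (`|\det (matrix_of_family A w)| <=
      0 * Num.sqrt (\sum_j cofactor (matrix_of_family A w) ord0 j ^+ 2)) &&
      (\sum_j cofactor (matrix_of_family A w) ord0 j ^+ 2 != 0)].
have mS : measurable S by exact: measurable_gaussian_det_small_ball.
have N1S : N1 `<=` N0 `|` S.
  move=> w /= /eqP d0; rewrite /S /N0 /= d0 normr0 mul0r lexx /=.
  set sw := \sum_j _; have [s0|sw0] := eqVneq sw 0; last by right.
  left; move/eqP: s0; rewrite psumr_eq0 => [|*]; last exact: sqr_ge0.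
  move=> /allP/(_ ord0 (mem_index_enum _)) /=.
  by rewrite sqrf_eq0 cofactorE mul1r.
apply/eqP; rewrite eq_le measure_ge0 andbT.
apply: (@le_trans _ _ (P (N0 `|` S))).
  by rewrite le_measure// inE//; exact: measurableU.
apply: (le_trans (measureU2 _ mN0 mS)).
rewrite [X in (X + _)%E]IHn// add0e.
exact: gaussian_det_small_ball.
Qed.

(* Rotating the rows so that [u] becomes a multiple of the [m]-th basis vector
   turns [\adj M *m u] into a multiple of the vector of cofactors of row [m]. *)
Lemma gaussian_adj_bound n (A : 'I_n.+1 * 'I_n.+1 -> T -> R) (u : 'cV[R]_n.+1)
    (m : 'I_n.+1) (y : R) :
  iid_gaussian P A -> 0 < u m ord0 -> 0 < y ->
  (P [set w | y ^+ 2 * \det (matrix_of_family A w) ^+ 2 <=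
     \sum_i (\adj (matrix_of_family A w) *m u) i ord0 ^+ 2]%R <=
   (Num.sqrt (\sum_i u i ord0 ^+ 2) / y)%:E)%E.
Proof.
move=> AA um y0; have [mA _] := AA.
have [Q [QQ gQ] Qu] := exists_gaussian_preserving P um.
set r := Num.sqrt _ in Qu *.
have r0 : 0 <= r by exact: sqrtr_ge0.
have BB := gQ _ _ AA.
set B : 'I_n.+1 * 'I_n.+1 -> T -> R := fun ik w => _ in BB.
have [mB _] := BB.
pose M := matrix_of_family A.
have BE w : matrix_of_family B w = Q *m M w.
  by apply/matrixP => i j; rewrite !mxE; apply: eq_bigr => k _; rewrite mxE.
have dQ : \det Q ^+ 2 = 1 by rewrite expr2 -{1}det_tr -det_mulmx QQ det1.
have dQ0 : \det Q != 0 by rewrite -sqrf_eq0 dQ oner_eq0.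
pose s w := \sum_j cofactor (matrix_of_family B w) m j ^+ 2.
have adjE w : \det (M w) != 0 ->
    \sum_i (\adj (M w) *m u) i ord0 ^+ 2 = r ^+ 2 * s w.
  move=> dM.
  have uM : M w \in unitmx by rewrite unitmxE unitfE.
  (* Both sides become det(Q M) times the identity after multiplication by the invertible [M w] on
     the right. *)
  have E : \adj (Q *m M w) *m Q = \det Q *: \adj (M w).
    apply: (can_inj (mulmxK uM)).
    rewrite -mulmxA mul_adj_mx det_mulmx -scalemxAl mul_adj_mx.
    by rewrite scale_scalar_mx.
  have E2 : r *: col m (\adj (matrix_of_family B w)) = \det Q *: (\adj (M w) *m u).
    rewrite scalemxAl -E BE -mulmxA Qu -scalemxAr; congr (_ *: _).
    by rewrite colE.
  rewrite /s mulr_sumr; apply: eq_bigr => i _.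
  rewrite -[LHS]mul1r -dQ -exprMn -[X in X ^+ 2 = _]/(_ * _).
  have -> : \det Q * (\adj (M w) *m u) i ord0 = r * cofactor (matrix_of_family B w) m i.
    by have /matrixP/(_ i ord0) := E2; rewrite !mxE.
  by rewrite exprMn.
pose S := [set w | (`|\det (matrix_of_family B w)| <= (r / y) * Num.sqrt (s w)) &&
      (s w != 0)].
(* Every singular matrix satisfies the inequality, its left side being 0; such matrices are
   collected in this null event, and [S] covers the invertible ones. *)
pose N0 := [set w | \det (M w) == 0].
have mS : measurable S by exact: measurable_gaussian_det_small_ball.
have mN0 : measurable N0.
  apply: measurable_set_bool; apply: measurable_fun_eqr => //.
  exact: measurable_det_family.
apply: (@le_trans _ _ (P (N0 `|` S))).
  rewrite le_measure// ?inE; last 2 first.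
  - exact: measurableU.
  - move=> w /=; rewrite /N0 /S /=; have [->|dM] := eqVneq (\det (M w)) 0; first by left.
    rewrite adjE// => H; right.
    have sw : s w != 0.
      apply/negP => /eqP s0; move: H; rewrite s0 mulr0 leNgt => /negP; apply.
      by apply: mulr_gt0; [exact: exprn_gt0|rewrite exprn_even_gt0].
    rewrite sw andbT -(@ler_pXn2r _ 2)// ?nnegrE ?mulr_ge0 ?sqrtr_ge0 ?invr_ge0
      ?(ltW y0)//.
    rewrite real_normK ?num_real// BE det_mulmx exprMn dQ mul1r exprMn sqr_sqrtr.
      by rewrite expr_div_n mulrAC ler_pdivlMr ?exprn_gt0// mulrC.
    by apply: sumr_ge0 => *; exact: sqr_ge0.
  apply: measurable_set_bool; apply: measurable_fun_ler.
    by apply: measurable_funM => //; apply: measurable_funX; exact: measurable_det_family.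
  apply: measurable_sum => i; apply: measurable_funX.
  rewrite (_ : (fun w => _) =
      (fun w => \sum_j cofactor (M w) j i * u j ord0)); last first.
    by apply/funext => w; rewrite mxE; apply: eq_bigr => j _; rewrite mxE.
  by apply: measurable_sum => j; apply: measurable_funM => //; exact: measurable_cofactor.
apply: (le_trans (measureU2 _ mN0 mS)).
rewrite [X in (X + _)%E]gaussian_det_null// add0e.
by apply: gaussian_det_small_ball => //; rewrite divr_ge0// ltW.
Qed.

End random_matrix_inverse.

(** * Anticoncentration of random sign sums *)

Section sign_vectors.
Context {R : realFieldType}.

Lemma cauchy_schwarz_sum (I : Type) (r : seq I) (a b : I -> R) :
  (\sum_(i <- r) a i * b i) ^+ 2 <=
  (\sum_(i <- r) a i ^+ 2) * (\sum_(i <- r) b i ^+ 2).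
Proof.
set s := \sum_(i <- r) a i * b i.
set A := \sum_(i <- r) a i ^+ 2; set B := \sum_(i <- r) b i ^+ 2.
have B0 : 0 <= B by apply: sumr_ge0 => *; exact: sqr_ge0.
have A0 : 0 <= A by apply: sumr_ge0 => *; exact: sqr_ge0.
have key (x y : R) : 0 <= x ^+ 2 * A - 2 * x * y * s + y ^+ 2 * B.
  have -> : x ^+ 2 * A - 2 * x * y * s + y ^+ 2 * B =
      \sum_(i <- r) (x * a i - y * b i) ^+ 2.
    rewrite /A /B /s !mulr_sumr -sumrB -big_split/=.
    by apply: eq_bigr => i _; ring.
  by apply: sumr_ge0 => *; exact: sqr_ge0.
have [B1|B1] := ltP 0 B.
  rewrite -(@ler_pM2l _ B)//; have := key B s.
  have -> : B ^+ 2 * A - 2 * B * s * s + s ^+ 2 * B = B * (A * B) - B * s ^+ 2.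
    by ring.
  by rewrite subr_ge0.
have B00 : B = 0 by apply/eqP; rewrite eq_le B0 B1.
have [->|s0] := eqVneq s 0; first by rewrite expr0n B00 mulr0.
(* When [B = 0] the quadratic form is affine in its second argument; this value makes it equal to
   -1, contradicting [key]. *)
have := key 1 ((A + 1) / (2 * s)); rewrite B00.
have -> : 2 * 1 * ((A + 1) / (2 * s)) * s = A + 1 by field.
by rewrite expr1n; lra.
Qed.

Variables (n : nat) (a : 'I_n -> R).
Local Notation eps := {ffun 'I_n -> bool}.
Local Notation c := (#|{: eps}|%:R : R).

Let flip (k : 'I_n) (e : eps) : eps := [ffun i => if i == k then ~~ e i else e i].

Let flipK k : involutive (flip k).
Proof.
by move=> e; apply/ffunP => i; rewrite !ffunE; case: eqP => // _; rewrite negbK.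
Qed.

Let S (r : seq 'I_n) (e : eps) : R := \sum_(i <- r) (-1) ^+ (e i) * a i.

Let S_flip k r e : k \notin r -> S r (flip k e) = S r e.
Proof.
move=> kr; apply: eq_big_seq => i ir; rewrite ffunE.
by case: eqP => // ik; rewrite ik (negbTE kr) in ir.
Qed.

(** Flipping the sign at [k] is an involution that negates each term, because [S r] does not involve
    coordinate [k]. This removes the odd terms in the moments below. *)
Let sum_sign k r (p : nat) : k \notin r ->
  \sum_(e : eps) (-1) ^+ (e k) * S r e ^+ p = 0.
Proof.
move=> kr; set s := \sum_e _.
suff : s = - s by move=> ss; lra.
rewrite {1}/s (reindex_inj (inv_inj (flipK k)))/= -sumrN.
apply: eq_bigr => e _; rewrite S_flip// ffunE eqxx.
by case: (e k); rewrite /= ?expr0 ?expr1 ?mul1r ?mulN1r ?opprK.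
Qed.

Let S_cons k r e : S (k :: r) e = (-1) ^+ (e k) * a k + S r e.
Proof. by rewrite /S big_cons. Qed.

Let sum2 r : uniq r -> \sum_(e : eps) S r e ^+ 2 = c * \sum_(i <- r) a i ^+ 2.
Proof.
elim: r => [|k r IHr] /=.
  by rewrite big_nil mulr0 big1// => e _; rewrite /S big_nil expr0n.
move=> /andP[kr ur]; rewrite big_cons.
transitivity (\sum_(e : eps)
  (a k ^+ 2 + 2 * a k * ((-1) ^+ (e k) * S r e ^+ 1) + S r e ^+ 2)).
  by apply: eq_bigr => e _; rewrite S_cons; case: (e k); rewrite /= ?expr0 ?expr1; ring.
rewrite !big_split/= -[X in _ + X + _]mulr_sumr sum_sign// mulr0 addr0 IHr// sumr_const.
by rewrite mulrDr -[X in X + _ = _]mulr_natl.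
Qed.

(** Up to the factor [c], this is the fourth moment of a Rademacher sum. Adding a coefficient [a] to
    a sum of variance V contributes a^4 + 6 a^2 V, within the increment 3 a^4 + 6 a^2 V of 3 (a^2 +
    V)^2. *)
Let sum4 r : uniq r -> \sum_(e : eps) S r e ^+ 4 <= 3 * c * (\sum_(i <- r) a i ^+ 2) ^+ 2.
Proof.
elim: r => [|k r IHr] /=.
  rewrite big_nil expr0n/= mulr0 big1// => e _.
  by rewrite /S big_nil expr0n.
move=> /andP[kr ur]; rewrite big_cons.
have -> : \sum_(e : eps) S (k :: r) e ^+ 4 =
  \sum_(e : eps) (a k ^+ 4 + 4 * a k ^+ 3 * ((-1) ^+ (e k) * S r e ^+ 1) +
     6 * a k ^+ 2 * S r e ^+ 2 + 4 * a k * ((-1) ^+ (e k) * S r e ^+ 3) + S r e ^+ 4).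
  by apply: eq_bigr => e _; rewrite S_cons; case: (e k); rewrite /= ?expr0 ?expr1; ring.
rewrite !big_split/= -[X in _ + X + _ + _ + _]mulr_sumr.
rewrite -[X in _ + _ + X + _ + _]mulr_sumr -[X in _ + _ + _ + X + _]mulr_sumr.
rewrite (sum_sign 1 kr) (sum_sign 3 kr) !mulr0 !addr0 sum2// sumr_const.
rewrite -[a k ^+ 4 *+ _]mulr_natl.
have := IHr ur; set V := \sum_(i <- r) _; set M := \sum_e _.
have c0 : 0 <= c by [].
have a4 : 0 <= c * a k ^+ 4 by rewrite mulr_ge0// exprn_even_ge0.
move=> HM.
have -> : 3 * c * (a k ^+ 2 + V) ^+ 2 =
  3 * c * V ^+ 2 + (6 * a k ^+ 2 * (c * V)) + 3 * (c * a k ^+ 4) by ring.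
lra.
Qed.

(** The two fractions have different effects later: the threshold 1/5 becomes the factor 5 in the
    bound on the inverse, and the proportion 1/5 the factor 5 lost in Markov's inequality. *)
Lemma sign_vector_anticoncentration :
  5^-1 * c <= #|[pred e : eps | 5^-1 * (\sum_i a i ^+ 2) <=
                  (\sum_i (-1) ^+ (e i) * a i) ^+ 2]|%:R.
Proof.
pose V := \sum_i a i ^+ 2.
have c0 : 0 <= c by [].
have V0 : 0 <= V by apply: sumr_ge0 => *; exact: sqr_ge0.
have ur : uniq (index_enum 'I_n : seq 'I_n) by exact: index_enum_uniq.
have H2 : \sum_(e : eps) S (index_enum _) e ^+ 2 = c * V by exact: sum2.
have H4 : \sum_(e : eps) S (index_enum _) e ^+ 4 <= 3 * c * V ^+ 2 by exact: sum4.
set W := [pred e : eps | _].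
have WE e : (e \in W) = (5^-1 * V <= S (index_enum _) e ^+ 2) by rewrite inE.
have [V1|V1] := ltP 0 V; last first.
  have -> : #|W| = #|{: eps}|.
    apply: eq_card => e; rewrite WE (le_trans _ (sqr_ge0 _))//.
    by rewrite pmulr_rle0// invr_gt0.
  by lra.
(* For [t = q / V] the indicator of [1 / 5 <= t] is at least
   [1 - (t - 7 / 2)^2 / (33 / 10)^2], whose mean over the signs is at least
   [1 - (3 - 7 + 49 / 4) / (1089 / 100) > 1 / 5]. *)
have : \sum_(e : eps) ((1089 / 100) * V ^+ 2 -
      (S (index_enum _) e ^+ 2 - (7 / 2) * V) ^+ 2)
    <= \sum_(e : eps) ((1089 / 100) * V ^+ 2 * (e \in W)%:R).
  apply: ler_sum => e _; rewrite WE; set q := S _ e ^+ 2.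
  have q0 : 0 <= q by exact: sqr_ge0.
  have [h|h] := leP (5^-1 * V) q; rewrite /= ?mulr1 ?mulr0.
    by rewrite gerBl sqr_ge0.
  (* If [q < V / 5], then [q] is farther from [(7 / 2) * V] than (7/2 - 1/5) V = (33/10) V, so the
     left side is negative. *)
  by nra.
rewrite -mulr_sumr.
have -> : \sum_(e : eps) (e \in W)%:R = #|W|%:R :> R.
  rewrite -sum1_card natr_sum [RHS]big_mkcond/=.
  by apply: eq_bigr => e _; case: (e \in W).
have -> : \sum_(e : eps) ((1089 / 100) * V ^+ 2 -
      (S (index_enum _) e ^+ 2 - (7 / 2) * V) ^+ 2) =
    - (\sum_(e : eps) S (index_enum _) e ^+ 4) + 7 * V * (c * V)
    - (136 / 100) * (c * V ^+ 2).
  transitivity (\sum_(e : eps) (- S (index_enum _) e ^+ 4 +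
      7 * V * S (index_enum _) e ^+ 2 - (136 / 100) * V ^+ 2)).
    by apply: eq_bigr => e _; field.
  rewrite sumrB big_split/= sumrN -mulr_sumr H2 sumr_const.
  by rewrite -[X in _ - X = _]mulr_natl; congr (_ - _); rewrite mulrCA.
move=> H; have V2 : 0 < V ^+ 2 by exact: exprn_gt0.
rewrite -(ler_pM2r V2); move: H H4.
have -> : 7 * V * (c * V) = 7 * (c * V ^+ 2) by ring.
have -> : 5^-1 * c * V ^+ 2 = 5^-1 * (c * V ^+ 2) by ring.
have -> : 3 * c * V ^+ 2 = 3 * (c * V ^+ 2) by ring.
have -> : (1089 / 100) * V ^+ 2 * #|W|%:R = (1089 / 100) * (#|W|%:R * V ^+ 2) by ring.
have : 0 <= c * V ^+ 2 by rewrite mulr_ge0// ltW.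
lra.
Qed.

End sign_vectors.

(** * From sign vectors to the norm of the inverse *)

Section inverse_norm.
Context {R : realType}.

Definition sign_vector n (e : {ffun 'I_n -> bool}) : 'cV[R]_n :=
  \col_i (-1) ^+ (e i).

(* With the adjugate, a singular matrix amplifies every sign vector, so having
   few amplified sign vectors already forces invertibility. *)
Definition amplified_signs n (M : 'M[R]_n) (y : R) : pred {ffun 'I_n -> bool} :=
  [pred e | y ^+ 2 * \det M ^+ 2 <= \sum_i (\adj M *m sign_vector e) i ord0 ^+ 2].

(** The transpose is bounded first. For a = M^-T w, counting gives a sign vector e that is not
    amplified and has <a, e>^2 >= |a|^2 / 5; since <a, e> = <w, M^-1 e>, Cauchy-Schwarz bounds |a|.
    Duality then carries the bound from M^-T to M^-1. *)
Lemma invmx_bound_of_signs n (M : 'M[R]_n) (y : R) : 0 < y ->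
  #|amplified_signs M y|%:R < 5^-1 * #|{ffun 'I_n -> bool}|%:R :> R ->
  M \in unitmx /\ forall v : 'cV[R]_n,
    \sum_i (invmx M *m v) i ord0 ^+ 2 <= 5 * y ^+ 2 * \sum_i v i ord0 ^+ 2.
Proof.
move=> y0 few.
have c0 : 0 <= #|{ffun 'I_n -> bool}|%:R :> R by [].
have dM : \det M != 0.
  apply: contraTneq few => dM; rewrite -leNgt.
  have -> : #|amplified_signs M y| = #|{ffun 'I_n -> bool}|.
    apply: eq_card => e; rewrite !inE dM expr0n mulr0.
    by apply: sumr_ge0 => i _; exact: sqr_ge0.
  by lra.
have uM : M \in unitmx by rewrite unitmxE unitfE.
split => // v; set z := invmx M *m v.
have dual (w : 'cV[R]_n) :
    \sum_i ((invmx M)^T *m w) i ord0 ^+ 2 <= 5 * y ^+ 2 * \sum_i w i ord0 ^+ 2.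
  set a := (invmx M)^T *m w.
  have := sign_vector_anticoncentration (fun i => a i ord0).
  set W := [pred e | _] => cW.
  have [e eW eA] : exists2 e, e \in W & e \notin amplified_signs M y.
    apply/fintype.subsetPn/negP => /subset_leq_card.
    by rewrite -(ler_nat R) leNgt (lt_le_trans few).
  have aw : \sum_i (-1) ^+ (e i) * a i ord0 =
      \sum_i w i ord0 * (invmx M *m sign_vector e) i ord0.
    transitivity ((a^T *m sign_vector e) ord0 ord0).
      by rewrite mxE; apply: eq_bigr => i _; rewrite !mxE mulrC.
    rewrite /a trmx_mul trmxK -mulmxA mxE.
    by apply: eq_bigr => i _; rewrite mxE.
  have Me : \sum_i (invmx M *m sign_vector e) i ord0 ^+ 2 <= y ^+ 2.
    have dM2 : 0 < \det M ^+ 2 by rewrite exprn_even_gt0.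
    rewrite -(ler_pM2r dM2); move: eA; rewrite inE -ltNge => /ltW.
    apply: le_trans; rewrite mulr_suml ler_sum// => i _.
    rewrite -exprMn mulrC /invmx uM -scalemxAl mxE mulrA divff// mul1r.
    exact: lexx.
  move: eW; rewrite inE /= aw => le_a.
  have := le_trans le_a (cauchy_schwarz_sum _ _ _).
  set A := \sum_i a i ord0 ^+ 2; set B := \sum_i w i ord0 ^+ 2 => AB.
  have B0 : 0 <= B by apply: sumr_ge0 => i _; exact: sqr_ge0.
  have := le_trans AB (ler_wpM2l B0 Me).
  by lra.
have zz : \sum_i z i ord0 ^+ 2 =
    \sum_i ((invmx M)^T *m z) i ord0 * v i ord0.
  transitivity ((z^T *m z) ord0 ord0).
    by rewrite mxE; apply: eq_bigr => i _; rewrite [X in _ = X * _]mxE expr2.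
  rewrite {2}/z mulmxA mxE; apply: eq_bigr => i _; congr (_ * _).
  by rewrite -[invmx M in LHS]trmxK -trmx_mul mxE.
have := cauchy_schwarz_sum (index_enum _)
  (fun i => ((invmx M)^T *m z) i ord0) (fun i => v i ord0).
rewrite -zz; have := dual z.
set Z := \sum_i z i ord0 ^+ 2; set V := \sum_i v i ord0 ^+ 2.
set D := \sum_i _ ^+ 2 => DZ ZDV.
have V0 : 0 <= V by apply: sumr_ge0 => i _; exact: sqr_ge0.
have Z0 : 0 <= Z by apply: sumr_ge0 => i _; exact: sqr_ge0.
have [Z1|Z1] := ltP 0 Z; last first.
  by apply: (le_trans Z1); do 2![apply: mulr_ge0 => //]; exact: sqr_ge0.
rewrite -(ler_pM2l Z1) -expr2 (le_trans ZDV)// (le_trans (ler_wpM2r V0 DZ))//.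
by rewrite [leLHS]mulrAC [leRHS]mulrC.
Qed.

Context {d : measure_display} {T : measurableType d}.
Variable P : probability T R.

(** The factor sqrt(n + 1) in [y] cancels the Euclidean norm of a sign vector. Multiplying the
    vector by its first sign supplies the positive entry for [gaussian_adj_bound] and leaves all
    squares unchanged. *)
Lemma gaussian_amplified_bound n (A : 'I_n.+1 * 'I_n.+1 -> T -> R)
    (e : {ffun 'I_n.+1 -> bool}) (x : R) : iid_gaussian P A -> 0 < x ->
  let y := x * Num.sqrt n.+1%:R in
  let B := [set w | e \in amplified_signs (matrix_of_family A w) y] in
  measurable B /\ (P B <= (x^-1)%:E)%E.
Proof.
move=> AA x0 y B; have [mA _] := AA.
have n0 : 0 < Num.sqrt n.+1%:R :> R by rewrite sqrtr_gt0.
have y0 : 0 < y by rewrite mulr_gt0.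
have mB : measurable B.
  apply: measurable_set_bool; apply: measurable_fun_ler.
    by apply: measurable_funM => //; apply: measurable_funX; exact: measurable_det_family.
  apply: measurable_sum => i; apply: measurable_funX.
  rewrite (_ : (fun w => _) = (fun w => \sum_j cofactor (matrix_of_family A w) j i *
    sign_vector e j ord0)); last first.
    by apply/funext => w; rewrite mxE; apply: eq_bigr => j _; rewrite mxE.
  by apply: measurable_sum => j; apply: measurable_funM => //; exact: measurable_cofactor.
split => //.
have norm_sign (b : bool) :
    \sum_(i < n.+1) ((-1) ^+ b *: sign_vector e) i ord0 ^+ 2 = n.+1%:R.
  rewrite (eq_bigr (fun=> 1)); first by rewrite sumr_const card_ord.
  move=> i _; rewrite !mxE exprMn -!exprM mulnC [(_ * 2)%N]mulnC !exprM sqrrN.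
  by rewrite expr1n !expr1n mulr1.
have pos : 0 < ((-1) ^+ (e ord0) *: sign_vector e) ord0 ord0.
  by rewrite !mxE -expr2 -exprM mulnC exprM sqrrN expr1n expr1n.
have := gaussian_adj_bound AA pos y0; rewrite norm_sign.
have -> : Num.sqrt n.+1%:R / y = x^-1.
  by rewrite /y invfM mulrCA divff ?mulr1// gt_eqF.
apply: le_trans; rewrite le_eqVlt; apply/orP; left; apply/eqP; congr (P _).
have E w : \sum_i (\adj (matrix_of_family A w) *m
      ((-1) ^+ e ord0 *: sign_vector e)) i ord0 ^+ 2
    = \sum_i (\adj (matrix_of_family A w) *m sign_vector e) i ord0 ^+ 2.
  apply: eq_bigr => i _; rewrite -scalemxAr mxE exprMn -exprM mulnC exprM sqrrN.
  by rewrite expr1n expr1n mul1r.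
by apply/seteqP; split => w; rewrite /B /= inE E.
Qed.

Lemma gaussian_invmx_bound n (A : 'I_n * 'I_n -> T -> R) (x : R) :
  (0 < n)%N -> iid_gaussian P A -> 0 < x ->
  exists B : set T, [/\ measurable B, (P B <= (5 / x)%:E)%E &
    forall w, ~ B w -> let M := matrix_of_family A w in
      M \in unitmx /\ forall v : 'cV[R]_n,
      \sum_i (invmx M *m v) i ord0 ^+ 2 <=
        5 * (x ^+ 2 * n%:R) * \sum_i v i ord0 ^+ 2].
Proof.
case: n A => // n A _ AA x0; pose y := x * Num.sqrt n.+1%:R.
have y0 : 0 < y by rewrite mulr_gt0// sqrtr_gt0.
have y2 : y ^+ 2 = x ^+ 2 * n.+1%:R by rewrite exprMn sqr_sqrtr.
pose eps := {ffun 'I_n.+1 -> bool}.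
pose c : R := #|eps|%:R.
have c0 : 0 < c by rewrite ltr0n; apply/card_gt0P; exists [ffun=> true].
pose Be (e : eps) := [set w | e \in amplified_signs (matrix_of_family A w) y].
have mBe e : measurable (Be e) by have [] := gaussian_amplified_bound e AA x0.
have PBe e : (P (Be e) <= (x^-1)%:E)%E by have [] := gaussian_amplified_bound e AA x0.
have cardE w : #|amplified_signs (matrix_of_family A w) y|%:R = \sum_e \1_(Be e) w :> R.
  rewrite -sum1_card natr_sum big_mkcond/=; apply: eq_bigr => e _.
  rewrite indicE; case: ifPn => ew; first by rewrite mem_set.
  by rewrite memNset//; apply/negP.
pose B := [set w | 5^-1 * c <= \sum_e \1_(Be e) w].
have msum : measurable_fun setT (fun w => \sum_e \1_(Be e) w : R).
  by apply: measurable_sum => e; exact: measurable_indic.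
exists B; split.
- by apply: measurable_set_bool; exact: measurable_fun_ler.
- have mB : measurable B by apply: measurable_set_bool; exact: measurable_fun_ler.
  (* Markov's inequality written out: the number of amplified signs has mean at most c/x, so it
     reaches c/5 with probability at most 5/x. *)
  have : (\int[P]_w ((5^-1 * c)%:E * (\1_B w)%:E) <= \int[P]_w \sum_e (\1_(Be e) w)%:E)%E.
    apply: ge0_le_integral => //.
    + by move=> w _; rewrite -EFinM lee_fin mulr_ge0// mulr_ge0// ltW.
    + by apply: measurable_funeM; apply/measurable_EFinP; exact: measurable_indic.
    + by apply: emeasurable_sum => e; apply/measurable_EFinP; exact: measurable_indic.
    + move=> w _; rewrite sumEFin -EFinM lee_fin indicE.
      have [|nB] := boolP (w \in B); first by rewrite inE mulr1.
      by rewrite mulr0 sumr_ge0.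
  rewrite ge0_integralZl//; last 2 first.
  + by apply/measurable_EFinP; exact: measurable_indic.
  + by rewrite lee_fin mulr_ge0// ltW.
  rewrite integral_indic// setIT.
  rewrite ge0_integral_sum//; last first.
    by move=> e; apply/measurable_EFinP; exact: measurable_indic.
  have le1 : (\sum_e \int[P]_w (\1_(Be e) w)%:E <= \sum_(e : eps) (x^-1)%:E)%E.
    by apply: lee_sum => e _; rewrite integral_indic// setIT; exact: PBe.
  move=> /le_trans /(_ le1); rewrite sumEFin sumr_const => PBx.
  have PBfin : P B \is a fin_num by exact: fin_num_measure.
  have H : 5^-1 * c * fine (P B) <= c * x^-1.
    rewrite -lee_fin EFinM fineK//; apply: (le_trans PBx).
    by rewrite lee_fin -[leLHS]mulr_natl.
  rewrite -(fineK PBfin) lee_fin.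
  have c5 : 0 < 5^-1 * c by rewrite mulr_gt0.
  rewrite -(ler_pM2l c5) (le_trans H)// le_eqVlt; apply/orP; left; apply/eqP.
  by field; rewrite gt_eqF.
- move=> w nB M; rewrite -y2; apply: invmx_bound_of_signs => //.
  by rewrite cardE ltNge; apply/negP.
Qed.

End inverse_norm.

(** * The tail of the information *)

Section weighted_chernoff.
Context {R : realType} {d : measure_display} {T : measurableType d}.
Variable P : probability T R.
Local Open Scope ereal_scope.

(** Only the exponential moment of each single variable enters: Markov's inequality applies to the
    weighted sum [Z] of the exponentials, and convexity turns the bound [Z < S * a] into one on the
    weighted sum of the variables. *)
Lemma weighted_chernoff (p : nat -> R) (X : nat -> T -> R) (S M t : R) :
  (forall j, 0 <= p j)%R -> \sum_(0 <= j <oo) (p j)%:E = S%:E ->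
  (forall j, measurable_fun [set: T] (X j)) -> (forall j w, 0 <= X j w)%R ->
  (forall j, \int[P]_w (expR (X j w / 4))%:E <= M%:E) -> (0 <= M)%R -> (4 <= t)%R ->
  exists B : set T, [/\ measurable B, P B <= (M * expR (- (t / 4)))%:E &
    forall w, ~ B w -> \sum_(0 <= j <oo) (p j * X j w)%:E <= (t * S)%:E].
Proof.
move=> p0 pS mX X0 XM M0 t4.
have S0 : (0 <= S)%R.
  by rewrite -lee_fin -pS; apply: nneseries_ge0 => j _ _; rewrite lee_fin.
pose Z w := \sum_(0 <= j <oo) (p j * expR (X j w / 4))%:E.
have Zj0 j w : 0 <= (p j * expR (X j w / 4))%:E by rewrite lee_fin mulr_ge0// expR_ge0.
have mZj j : measurable_fun [set: T] (fun w => (p j * expR (X j w / 4))%:E).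
  apply/measurable_EFinP; apply: measurable_funM => //; apply: measurableT_comp => //.
  exact: measurable_funM.
have mZ : measurable_fun [set: T] Z.
  exact: (@ge0_emeasurable_sum _ _ _ _ _ xpredT).
have intZ : \int[P]_w Z w <= (S * M)%:E.
  rewrite /Z integral_nneseries//.
  apply: (@le_trans _ _ (\sum_(0 <= j <oo) (M%:E * (p j)%:E))).
    apply: lee_nneseries => [j _ _|j _]; first exact: integral_ge0.
    under eq_integral do rewrite EFinM.
    rewrite ge0_integralZl//; last 2 first.
    - apply/measurable_EFinP; apply: measurableT_comp => //.
      exact: measurable_funM.
    - by rewrite lee_fin.
    by rewrite muleC lee_wpmul2r// lee_fin.
  rewrite nneseriesZl; last by move=> j _; rewrite lee_fin.
  by rewrite pS -EFinM mulrC.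
pose a := expR (t / 4).
have a0 : (0 < a)%R by exact: expR_gt0.
(* The tangent of [exp] at [t / 4] plays the role of Jensen's inequality for the
   infinite convex combination. *)
have tangent (x : R) : (x <= 4 * a^-1 * expR (x / 4) + (t - 4))%R.
  have := expR_ge1Dx ((x - t) / 4).
  have -> : expR ((x - t) / 4) = (a^-1 * expR (x / 4))%R.
    by rewrite mulrBl expRD expRN mulrC.
  by lra.
(* For [S = 0] the strict inequality cannot hold, but then all weights vanish; the disjunction
   covers this case with an empty exceptional set. *)
have bound w : Z w < (S * a)%:E \/ S = 0%R ->
    \sum_(0 <= j <oo) (p j * X j w)%:E <= (t * S)%:E.
  move=> ZS; apply: (@le_trans _ _ (\sum_(0 <= j <oo)
      ((4 * a^-1)%:E * (p j * expR (X j w / 4))%:E + (t - 4)%:E * (p j)%:E))).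
    apply: lee_nneseries => j _; first by rewrite lee_fin mulr_ge0.
    rewrite -!EFinM -EFinD lee_fin.
    have := ler_wpM2l (p0 j) (tangent (X j w)); lra.
  have a1 : (0 <= 4 * a^-1)%R by rewrite mulr_ge0// invr_ge0 ltW.
  have t40 : (0 <= t - 4)%R by rewrite subr_ge0.
  rewrite nneseriesD; last 2 first.
  - by move=> j _ _; rewrite mule_ge0// lee_fin.
  - by move=> j _ _; rewrite mule_ge0// lee_fin.
  rewrite !nneseriesZl; last 2 first.
  - by move=> j _; rewrite lee_fin.
  - by [].
  rewrite pS -EFinM.
  have -> : (t * S)%:E = (4 * S)%:E + ((t - 4) * S)%:E :> \bar R.
    by rewrite -EFinD; congr (_%:E); ring.
  apply: leeD2r; case: ZS => [/ltW ZS|S00].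
    apply: (le_trans (lee_wpmul2l _ ZS)); first by rewrite lee_fin.
    rewrite -EFinM lee_fin le_eqVlt; apply/orP; left; apply/eqP.
    by field; rewrite gt_eqF.
  rewrite S00 mulr0.
  have p00 j : p j = 0%R.
    apply/eqP; rewrite eq_le p0 andbT -lee_fin.
    apply: (@le_trans _ _ S%:E); last by rewrite S00.
    rewrite -pS (@nneseriesD1 _ (fun j => (p j)%:E) j xpredT)//.
      by rewrite leeDl// nneseries_ge0// => i _ _; rewrite lee_fin.
    by move=> i _; rewrite lee_fin.
  by under eq_eseriesr do rewrite p00 mul0r; rewrite eseries0// mule0.
have [S00|Spos] := eqVneq S 0%R.
  exists set0; split => //; last by move=> w _; apply: bound; right.
  by rewrite measure0 lee_fin mulr_ge0// expR_ge0.
have {}Spos : (0 < S)%R by rewrite lt_neqAle eq_sym Spos S0.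
pose B := [set w | (S * a)%:E <= Z w].
have mB : measurable B by rewrite -[B]setTI; exact: emeasurable_fun_c_infty.
exists B; split => //; last first.
  by move=> w nB; apply: bound; left; rewrite ltNge; apply/negP.
have : \int[P]_w ((S * a)%:E * (\1_B w)%:E) <= \int[P]_w Z w.
  apply: ge0_le_integral => //.
  - by move=> w _; rewrite -EFinM lee_fin mulr_ge0// mulr_ge0// ltW.
  - by apply: measurable_funeM; apply/measurable_EFinP; exact: measurable_indic.
  - move=> w _; rewrite -EFinM indicE; have [|nB] := boolP (w \in B).
      by rewrite inE mulr1.
    by rewrite mulr0 nneseries_ge0.
rewrite ge0_integralZl//; last 2 first.
- by apply/measurable_EFinP; exact: measurable_indic.
- by rewrite lee_fin mulr_ge0// ltW.
rewrite integral_indic// setIT => /le_trans/(_ intZ) PBx.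
have PBfin : P B \is a fin_num by exact: fin_num_measure.
have H : (S * a * fine (P B) <= S * M)%R by rewrite -lee_fin EFinM fineK.
rewrite -(fineK PBfin) lee_fin expRN ler_pdivlMr//.
by rewrite -(ler_pM2l Spos) [(fine _ * _)%R]mulrC mulrA.
Qed.

End weighted_chernoff.

(** * Least squares *)

Section worst_case.
Context {R : realType}.

Lemma nneseries_partial_le (f : nat -> R) (A : R) N : (forall j, 0 <= f j) ->
  (\sum_(0 <= j <oo) (f j)%:E <= A%:E)%E -> \sum_(0 <= j < N) f j <= A.
Proof.
move=> f0 fA; rewrite -lee_fin -sumEFin; apply: le_trans fA.
by apply: nneseries_lim_ge => j _; rewrite lee_fin.
Qed.

Lemma cauchy_schwarz_series (a b : nat -> R) (A B : R) :
  (\sum_(0 <= j <oo) (a j ^+ 2)%:E <= A%:E)%E ->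
  (\sum_(0 <= j <oo) (b j ^+ 2)%:E <= B%:E)%E ->
  cvgn [series a j * b j]_j /\ (limn [series a j * b j]_j) ^+ 2 <= A * B.
Proof.
move=> aA bB.
have pA N := nneseries_partial_le N (fun j => sqr_ge0 (a j)) aA.
have pB N := nneseries_partial_le N (fun j => sqr_ge0 (b j)) bB.
have A0 : 0 <= A by apply: le_trans (pA 0%N); rewrite big_geq.
have B0 : 0 <= B by apply: le_trans (pB 0%N); rewrite big_geq.
have sq0 (f : nat -> R) N : 0 <= \sum_(0 <= j < N) f j ^+ 2.
  by apply: sumr_ge0 => j _; exact: sqr_ge0.
have AB N : (\sum_(0 <= j < N) `|a j| * `|b j|) ^+ 2 <= A * B.
  apply: (le_trans (cauchy_schwarz_sum _ _ _)).
  under eq_bigr do rewrite real_normK ?num_real//.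
  under [X in _ * X <= _]eq_bigr do rewrite real_normK ?num_real//.
  exact: ler_pM.
have cvgs : cvgn [series a j * b j]_j.
  apply: normed_cvg; apply: nondecreasing_is_cvgn.
    by apply: nondecreasing_series => j _ _; exact: normr_ge0.
  (* A partial sum is either at most 1 or at most its own square, hence at most [A * B]; this bound
     avoids a square root. *)
  exists (A * B + 1) => _ [N _ <-] /=; rewrite /series/=.
  under eq_bigr do rewrite normrM.
  have := AB N; set s := \sum_(0 <= j < N) _ => sAB.
  have [s1|s1] := leP s 1; first by rewrite (le_trans s1)// lerDr mulr_ge0.
  rewrite (@le_trans _ _ (s ^+ 2))// ?(le_trans sAB)// ?lerDl//.
  by rewrite expr2 ler_peMr// ltW// (lt_trans ltr01).
split=> //.
have cs2 : (fun N => ([series a j * b j]_j N) ^+ 2) @ \oo -->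
    (limn [series a j * b j]_j) ^+ 2.
  by rewrite expr2; under eq_fun do rewrite expr2; apply: cvgM.
rewrite -(cvg_lim _ cs2)//; apply: limr_le; first by apply/cvg_ex; eexists; exact: cs2.
apply: nearW => N /=; apply: le_trans (AB N).
rewrite -[leLHS]real_normK ?num_real// ler_pXn2r ?nnegrE ?normr_ge0//.
  by rewrite (le_trans (ler_norm_sum _ _ _))//; under eq_bigr do rewrite normrM.
by apply: sumr_ge0 => j _; rewrite mulr_ge0.
Qed.

(** Finiteness forces [x j = 0] wherever [sigma j = 0]; there both divisions give 0, so the extended
    quotient may be replaced by that of the field. *)
Lemma hsqnorm_lty_div (sigma x : nat -> R) : (hsqnorm sigma x < +oo)%E ->
  (forall j, x j = sigma j * (x j / sigma j)) /\
  hsqnorm sigma x = (\sum_(0 <= j <oo) ((x j / sigma j) ^+ 2)%:E)%E.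
Proof.
move=> xoo.
have term0 j : (0 <= ((x j)%:E / (sigma j)%:E) ^+ 2)%E by rewrite expe2 sqre_ge0.
have x0 j : sigma j = 0 -> x j = 0.
  move=> sj; apply/eqP; apply: contraTT xoo => xj; rewrite -leNgt leye_eq.
  rewrite /hsqnorm (@nneseriesD1 _ _ j xpredT)//.
  by rewrite sj hsqnorm_div0// addye// gt_eqF// (lt_le_trans (ltNyr 0))// nneseries_ge0.
split=> [j|].
  have [sj|sj] := eqVneq (sigma j) 0; first by rewrite sj mul0r x0.
  by rewrite mulrCA divff// mulr1.
apply: eq_eseriesr => j _; have [sj|sj] := eqVneq (sigma j) 0.
  by rewrite sj x0// hsqnorm_div00 mul0r expr0n.
by rewrite inver (negbTE sj).
Qed.

Lemma l2norm_series (x : nat -> R) :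
  l2norm x = ((\sum_(0 <= j <oo) (x j ^+ 2)%:E) `^ 2^-1)%E.
Proof.
rewrite /l2norm Lnorm_counting//; congr (_ `^ _)%E.
apply: eq_eseriesr => j _ /=.
by rewrite powR_mulrn// real_normK ?num_real.
Qed.

Lemma moore_penrose_unitmx n (M : 'M[R]_n) : M \in unitmx ->
  moore_penrose M = invmx M.
Proof.
move=> uM; have [MXM _ _ _] := moore_penroseP M.
apply: (can_inj (mulKmx uM)); apply: (can_inj (mulmxK uM)).
by rewrite MXM mulmxV// mul1mx.
Qed.

Lemma series_split_tail (f : nat -> R) n : cvgn [series f (j + n)%N]_j ->
  cvgn (series f) /\
  limn (series f) = \sum_(j < n) f j + limn [series f (j + n)%N]_j.
Proof.
move=> cf; have H : series f @ \oo --> \sum_(j < n) f j + limn [series f (j + n)%N]_j.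
  rewrite -(cvg_shiftn n).
  rewrite (_ : (fun N => series f (N + n)%N) =
      (fun N => \sum_(j < n) f j + [series f (j + n)%N]_j N)); last first.
    apply/funext => N; rewrite /series/= addnC (big_cat_nat (n := n))//=; last first.
      by rewrite leq_addr.
    rewrite big_mkord; congr (_ + _).
    by rewrite -{1}(add0n n) big_addn addKn.
  by apply: cvgD => //; exact: cvg_cst.
by split; [apply/cvg_ex; eexists; exact: H|exact: cvg_lim].
Qed.

(** The first [n] coordinates of [x] are recovered up to M^-1 applied to the information of the
    tail, and the remaining ones are lost. Writing x = sigma y with |y| <= 1, Cauchy-Schwarz in each
    row bounds the tail information by its Hilbert-Schmidt norm, giving [L * t]; the lost
    coordinates give the 1. *)
Lemma worst_case_error_le n (G : 'I_n -> nat -> R) (sigma : nat -> R) (S L t : R) :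
  (\sum_(0 <= j <oo) (sigma (j + n)%N ^+ 2)%:E = S%:E)%E ->
  restr G n \in unitmx -> 0 <= L ->
  (forall v : 'cV[R]_n, \sum_i (invmx (restr G n) *m v) i ord0 ^+ 2 <=
    L * \sum_i v i ord0 ^+ 2) ->
  (\sum_(0 <= j <oo) (sigma (j + n)%N ^+ 2 * \sum_i G i (j + n)%N ^+ 2)%:E <=
    (t * S)%:E)%E ->
  (worst_case_error sigma (least_squares G n) <= (((1 + L * t) * S)%:E `^ 2^-1))%E.
Proof.
move=> sigmaS uM L0 ML tail.
apply: ge_ereal_sup => _ [x [x2 xE] <-].
have [xy hs] := hsqnorm_lty_div (le_lt_trans xE (ltry 1)).
pose y j := x j / sigma j.
have ysum : (\sum_(0 <= j <oo) (y j ^+ 2)%:E <= 1%:E)%E by rewrite -hs.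
have ytail : (\sum_(0 <= j <oo) (y (j + n)%N ^+ 2)%:E <= 1%:E)%E.
  apply: le_trans ysum.
  rewrite (@nneseries_addn R (fun j => (y j ^+ 2)%:E) n); last first.
    by move=> ?; rewrite lee_fin sqr_ge0.
  rewrite [leRHS](@nneseries_split R _ 0%N n); last first.
    by move=> *; rewrite lee_fin sqr_ge0.
  by rewrite add0n leeDr// sumEFin lee_fin sumr_ge0// => j _; exact: sqr_ge0.
pose D i := (\sum_(0 <= j <oo) ((G i (j + n)%N * sigma (j + n)%N) ^+ 2)%:E)%E.
have D0 i : (0 <= D i)%E by apply: nneseries_ge0 => j _ _; rewrite lee_fin sqr_ge0.
have sumD : (\sum_i D i <= (t * S)%:E)%E.
  apply: le_trans tail; rewrite /D -nneseries_sum; last first.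
    by move=> *; rewrite lee_fin sqr_ge0.
  rewrite le_eqVlt; apply/orP; left; apply/eqP; apply: eq_eseriesr => j _.
  rewrite sumEFin mulr_sumr; congr (_%:E); apply: eq_bigr => i _.
  by rewrite exprMn mulrC.
have Dfin i : D i \is a fin_num.
  rewrite ge0_fin_numE// (le_lt_trans _ (ltry (t * S)))// (le_trans _ sumD)//.
  by rewrite (bigD1 i)//= leeDl// sume_ge0.
have Tcs i : cvgn [series G i (j + n)%N * x (j + n)%N]_j /\
    (limn [series G i (j + n)%N * x (j + n)%N]_j) ^+ 2 <= fine (D i).
  have := @cauchy_schwarz_series (fun j => G i (j + n)%N * sigma (j + n)%N)
    (fun j => y (j + n)%N) (fine (D i)) 1.
  rewrite fineK// mulr1 => /(_ (lexx _) ytail).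
  rewrite (_ : (fun j => G i (j + n)%N * sigma (j + n)%N * y (j + n)%N) =
    (fun j => G i (j + n)%N * x (j + n)%N))//.
  by apply/funext => j; rewrite -mulrA -xy.
pose Tv : 'cV[R]_n := \col_i limn [series G i (j + n)%N * x (j + n)%N]_j.
pose xn : 'cV[R]_n := \col_j x j.
pose z := invmx (restr G n) *m Tv.
(* All rows converge on the ellipsoid, so no component is NaN and the default 0 is not reached. *)
have infoE : map_mx (odflt 0) (info G x) = restr G n *m xn + Tv.
  apply/matrixP => i j; rewrite !mxE/=.
  have [cu lu] := @series_split_tail (fun j => G i j * x j) n (Tcs i).1.
  rewrite asboolT//= lu; congr (_ + _).
  by apply: eq_bigr => k _; rewrite !mxE.
have lsE : least_squares G n x = embed (xn + z).
  by rewrite /least_squares infoE moore_penrose_unitmx// mulmxDr mulKmx.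
have errlt (k : 'I_n) : (least_squares G n x \- x) k = z k ord0.
  by rewrite lsE /embed /= valK [(xn + z) _ _]mxE [xn _ _]mxE addrAC subrr add0r.
have errge k : (n <= k)%N -> (least_squares G n x \- x) k = - x k.
  by move=> nk; rewrite lsE /embed /= insubF ?add0r// ltnNge nk.
have zL : \sum_i z i ord0 ^+ 2 <= L * (t * S).
  apply: (le_trans (ML _)); apply: ler_wpM2l => //.
  rewrite -lee_fin; apply: le_trans sumD; rewrite -sumEFin; apply: lee_sum => i _.
  by rewrite -(fineK (Dfin i)) lee_fin mxE; exact: (Tcs i).2.
have xS : (\sum_(n <= k <oo) ((x k) ^+ 2)%:E <= S%:E)%E.
  rewrite -sigmaS -(@nneseries_addn R (fun k => (x k ^+ 2)%:E) n); last first.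
    by move=> ?; rewrite lee_fin sqr_ge0.
  apply: lee_nneseries => j _; first by rewrite lee_fin sqr_ge0.
  rewrite lee_fin xy exprMn -[leRHS]mulr1 ler_wpM2l ?sqr_ge0//.
  have := nneseries_partial_le j.+1 (fun j => sqr_ge0 (y (j + n)%N)) ytail.
  rewrite big_nat_recr//=; apply: le_trans; rewrite lerDr.
  by apply: sumr_ge0 => k _; exact: sqr_ge0.
rewrite l2norm_series; apply: gt0_ler_poweR; rewrite ?invr_ge0//.
- by rewrite in_itv/= leey andbT nneseries_ge0// => k _ _; rewrite lee_fin sqr_ge0.
- rewrite in_itv/= leey andbT lee_fin mulrDl mul1r -mulrA.
  have S0 : 0 <= S.
    by rewrite -lee_fin -sigmaS nneseries_ge0// => k _ _; rewrite lee_fin sqr_ge0.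
  rewrite addr_ge0// (le_trans _ zL)// sumr_ge0// => i _; exact: sqr_ge0.
rewrite (@nneseries_split R _ 0%N n); last first.
  by move=> *; rewrite lee_fin sqr_ge0.
rewrite add0n mulrDl mul1r addrC EFinD; apply: leeD.
  apply: le_trans xS; rewrite eseries_cond [leRHS]eseries_cond.
  by apply: lee_nneseries => [k _ _|k nk]; rewrite lee_fin ?sqr_ge0// errge// sqrrN.
rewrite big_mkord sumEFin lee_fin -mulrA.
by under eq_bigr do rewrite errlt.
Qed.

End worst_case.

Lemma ell2_embed (R : realType) k (v : 'cV[R]_k) : ell2 (embed v).
Proof.
rewrite /ell2 /= l2norm_series (@nneseries_split R _ 0%N k); last first.
  by move=> *; rewrite lee_fin sqr_ge0.
rewrite add0n eseries_cond eseries0 ?adde0 => [|j _ kj]; last first.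
  by rewrite /embed insubF ?expr0n// ltnNge; move/andP: kj => [_ ->].
by rewrite sumEFin poweR_EFin ltry.
Qed.

(** Least squares sees [x] only through its information, and its outputs have finite support; the
    comparison therefore holds for every matrix. *)
Lemma information_radius_le_least_squares (R : realType) n k
    (G : 'I_n -> nat -> R) (sigma : nat -> R) :
  (information_radius G sigma <= worst_case_error sigma (least_squares G k))%E.
Proof.
apply: ereal_inf_lbound.
exists (fun y => embed (moore_penrose (restr G k) *m map_mx (odflt 0) y)) => //.
by move=> y _; exact: ell2_embed.
Qed.

(** This is the origin of the constant 6: the Chernoff exponent (3/2) c^2 n exceeds the target by
    c^2 n / 2, which absorbs the moment factor because sqrt 2 <= 3/2 <= exp(1/2) and c >= 1. *)
Lemma chi2_tail_le (R : realType) n (c : R) : 1 <= c ->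
  Num.sqrt 2 ^+ n * expR (- (6 * (c ^+ 2 * n%:R) / 4)) <= expR (- (c ^+ 2 * n%:R)).
Proof.
move=> c1.
have s2 : Num.sqrt 2 <= expR (2^-1) :> R.
  apply: le_trans (expR_ge1Dx _).
  have -> : 1 + 2^-1 = Num.sqrt ((3 / 2) ^+ 2) :> R.
    by rewrite sqrtr_sqr ger0_norm; lra.
  by rewrite ler_wsqrtr//; lra.
have s2n : Num.sqrt 2 ^+ n <= expR (n%:R * 2^-1) :> R.
  by rewrite expRM_natl lerXn2r ?nnegrE ?sqrtr_ge0 ?expR_ge0.
apply: (le_trans (ler_wpM2r (expR_ge0 _) s2n)).
rewrite -expRD ler_expR.
have c2 : 1 <= c ^+ 2 by rewrite expr_ge1// (le_trans ler01).
have := ler_wpM2r (ler0n R n) c2; lra.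
Qed.

(** The error is a supremum over an uncountable set; the probability is therefore bounded through a
    measurable event [E] on which the inequalities hold. *)
Theorem theorem4 (R : realType) (d : measure_display) (T : measurableType d)
    (P : probability T R) (sigma : nat -> R) (n : nat)
    (g : 'I_n -> nat -> {RV P >-> R}) (c s : R)
    (sigma_ell2 : ell2 sigma)
    (sigma_ge0 : forall j, 0 <= sigma j)
    (sigma_nincr : forall i j, (i <= j)%N -> sigma j <= sigma i)
    (n_gt0 : (0 < n)%N)
    (g_gauss : gaussian_matrix g)
    (c_ge1 : 1 <= c) (s_ge1 : 1 <= s) :
  let G := fun (w : T) (i : 'I_n) (j : nat) => g i j w in
  let eA := fun w : T => worst_case_error sigma (least_squares (G w) n) in
  exists E : set T,
    [/\ measurable E,
        E `<=` [set w | (information_radius (G w) sigma <= eA w)%E /\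
          (eA w <= (14 * s * n%:R)%:E *
            (\sum_(n <= j <oo) ((sigma j) ^+ 2)%:E) `^ 2^-1)%E] &
        ((1 - expR (- (c ^+ 2 * n%:R)) - c * Num.sqrt (2 * expR 1) / s)%:E
          <= P E)%E].
Proof.
move=> G eA.
have sq0 j : (0 <= (sigma j ^+ 2)%:E)%E by rewrite lee_fin sqr_ge0.
have c0 : 0 < c by exact: lt_le_trans c_ge1.
have s0 : 0 < s by exact: lt_le_trans s_ge1.
have n1 : 1 <= n%:R :> R by rewrite ler1n.
have sigma_lty : (\sum_(0 <= j <oo) (sigma j ^+ 2)%:E < +oo)%E.
  move: sigma_ell2; rewrite /ell2 /= l2norm_series.
  by apply: lty_poweRy; rewrite invr_eq0.
have tail_lty : (\sum_(n <= j <oo) (sigma j ^+ 2)%:E < +oo)%E.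
  apply: le_lt_trans sigma_lty; rewrite [leRHS](@nneseries_split R _ 0%N n)//.
  by rewrite add0n leeDr// sume_ge0.
have [S SE] : exists S : R, (\sum_(n <= j <oo) (sigma j ^+ 2)%:E = S%:E)%E.
  exists (fine (\sum_(n <= j <oo) (sigma j ^+ 2)%:E)%E).
  by rewrite fineK// ge0_fin_numE// nneseries_ge0.
have S0 : 0 <= S by rewrite -lee_fin -SE nneseries_ge0.
have SE' : (\sum_(0 <= j <oo) (sigma (j + n)%N ^+ 2)%:E = S%:E)%E.
  by rewrite (@nneseries_addn R (fun j => (sigma j ^+ 2)%:E) n).
have c2 : 1 <= c ^+ 2 by rewrite expr_ge1// ltW.
pose t := 6 * (c ^+ 2 * n%:R).
have t4 : 4 <= t.
  have : 1 * 1 <= c ^+ 2 * n%:R by rewrite ler_pM.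
  by rewrite /t; lra.
pose X j w := \sum_i g i (j + n)%N w ^+ 2.
have iidX j : iid_gaussian P (fun i : 'I_n => g i (j + n)%N : T -> R).
  have injh : injective (fun i : 'I_n => (i, (j + n)%N)) by move=> i k [].
  exact: (gaussian_matrix_iid g_gauss injh).
have mX j : measurable_fun [set: T] (X j).
  apply: measurable_sum => i; apply: measurable_funX; exact: (iidX j).1.
have X0 j w : 0 <= X j w by apply: sumr_ge0 => i _; exact: sqr_ge0.
have EX j : (\int[P]_w (expR (X j w / 4))%:E <= (Num.sqrt 2 ^+ n)%:E)%E.
  by rewrite (integral_expR_sum_sqr_gaussian (iidX j)).
have M0 : 0 <= Num.sqrt 2 ^+ n :> R by rewrite exprn_ge0// sqrtr_ge0.
have [B1 [mB1 PB1 B1E]] := weighted_chernoff (fun j => sqr_ge0 (sigma (j + n)%N))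
  SE' mX X0 EX M0 t4.
(* The squared error is at most [1 + 5 (x^2 n) t = 1 + (375 / 2) (s n)^2] times
   the tail sum, and [14 ^ 2 = 196]. *)
pose x := 5 / 2 * (s / c).
have x0 : 0 < x by rewrite mulr_gt0 ?divr_gt0.
pose A (ij : 'I_n * 'I_n) : T -> R := g ij.1 ij.2.
have iidA : iid_gaussian P A.
  have injh : injective (fun ij : 'I_n * 'I_n => (ij.1, ij.2 : nat)).
    by move=> [i j] [i' j'] /= [-> /val_inj ->].
  exact: (gaussian_matrix_iid g_gauss injh).
have [B2 [mB2 PB2 B2E]] : exists B : set T, [/\ measurable B, (P B <= (5 / x)%:E)%E &
    forall w, ~ B w -> restr (G w) n \in unitmx /\ forall v : 'cV[R]_n,
      \sum_i (invmx (restr (G w) n) *m v) i ord0 ^+ 2 <=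
        5 * (x ^+ 2 * n%:R) * \sum_i v i ord0 ^+ 2].
  exact: (gaussian_invmx_bound n_gt0 iidA x0).
exists (~` (B1 `|` B2)); split.
- by apply: measurableC; exact: measurableU.
- move=> w /not_orP[nB1 nB2]; split; first exact: information_radius_le_least_squares.
  have [uM ML] := B2E w nB2.
  have L0 : 0 <= 5 * (x ^+ 2 * n%:R).
    by apply: mulr_ge0 => //; apply: mulr_ge0 => //; exact: sqr_ge0.
  apply: (le_trans (worst_case_error_le SE' uM L0 ML (B1E w nB1))).
  rewrite SE !poweR_EFin -EFinM lee_fin.
  rewrite !powR12_sqrt//; last first.
    by rewrite mulr_ge0// addr_ge0// mulr_ge0// (le_trans _ t4).
  have a0 : 0 <= 14 * s * n%:R by rewrite !mulr_ge0// ltW.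
  have -> : 14 * s * n%:R * Num.sqrt S = Num.sqrt ((14 * s * n%:R) ^+ 2 * S).
    by rewrite sqrtrM ?sqr_ge0// sqrtr_sqr ger0_norm.
  rewrite ler_wsqrtr// ler_wpM2r//.
  have -> : 5 * (x ^+ 2 * n%:R) * t = (375 / 2) * (s * n%:R) ^+ 2.
    by rewrite /x /t; field; rewrite gt_eqF.
  have sn : 1 <= s * n%:R by exact: mulr_ege1.
  have : 1 <= (s * n%:R) ^+ 2 by rewrite expr_ge1// (le_trans ler01).
  have -> : (14 * s * n%:R) ^+ 2 = 196 * (s * n%:R) ^+ 2 by ring.
  lra.
- rewrite probability_setC; last exact: measurableU.
  have PU : (P (B1 `|` B2) <=
      (expR (- (c ^+ 2 * n%:R)) + c * Num.sqrt (2 * expR 1) / s)%:E)%E.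
    apply: (le_trans (measureU2 _ mB1 mB2)); rewrite EFinD; apply: leeD.
      by apply: (le_trans PB1); rewrite lee_fin; exact: chi2_tail_le.
    apply: (le_trans PB2); rewrite lee_fin.
    (* The inverse fails with probability at most [5 / x], that is 2 c / s, and e >= 2 gives 2 <=
       sqrt(2 e). *)
    have e2 : 2 <= Num.sqrt (2 * expR 1) :> R.
      rewrite -[leLHS](@ger0_norm R 2)// -sqrtr_sqr.
      by rewrite ler_wsqrtr// expr2 ler_pM2l//; exact: (expR_ge1Dx 1).
    have -> : 5 / x = 2 * (c / s) by rewrite /x; field; rewrite !gt_eqF.
    by rewrite -mulrA mulrCA ler_pM2l// ler_pM2r// invr_gt0.
  have -> : (1 - expR (- (c ^+ 2 * n%:R)) - c * Num.sqrt (2 * expR 1) / s)%:E =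
      (1 - (expR (- (c ^+ 2 * n%:R)) + c * Num.sqrt (2 * expR 1) / s)%:E)%E.
    by rewrite -EFinB opprD addrA.
  by apply: leeB.
Qed.
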